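(* In the setting described in the context (Markov processes $(X,P^x_{\omega,n})$ on $\Lambda_n$ satisfying Assumptions (1), (2), (3)), suppose in addition that, for $\mathbb{P}$-almost every $\omega$, the family $\{(X,P^0_{\omega,n}),\ n\ge 1\}$ of laws on $\mathcal{D}_T$ is relatively compact (for weak convergence of probability measures on $\mathcal{D}_T$ with the Skorokhod topology). Then $(X,P^0_{\omega,n})$ converge weakly in measure to Brownian motion; that is, for each bounded $F:\mathcal{D}_T\to\mathbb{R}$ continuous in the Skorokhod topology, $$E^0_{\omega,n}F(X)\to E_{BM}F(W)\quad\text{in } \mathbb{P}\text{-probability as } n\to\infty.$$
   Context: $(\Omega,\mathcal{F},\mathbb{P})$ is a probability space with expectation $\mathbb{E}$. Fix $T>0$. For $S>0$ let $\mathcal{D}_S=D([0,S],\mathbb{R}^d)$ be the Skorokhod space; $X$ denotes the coordinate process. $W$ is a standard $d$-dimensional Brownian motion started at $0$, and $E_{BM}$ the corresponding expectation. Let $\delta_n\to 0$ be positive numbers, $\Lambda_n=\delta_n\mathbb{Z}^d$, and let $\lambda_n$ be counting measure on $\Lambda_n$ normalized (multiplied by a constant) so that $\lambda_n\to dx$ weakly (tested against compactly supported continuous functions), where $dx$ is Lebesgue measure on $\mathbb{R}^d$. For each $\omega\in\Omega$ and $n\ge 1$ let $X^{(n)}=(X_t,\ t\ge 0,\ P^x_{\omega,n},\ x\in\Lambda_n)$ be a (time-homogeneous) Markov process with values in $\Lambda_n$, with expectations $E^x_{\omega,n}$ and semigroup $P^{(\omega,n)}_tf(x)=E^x_{\omega,n}f(X_t)$.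 Assumptions: (1) For each $\omega$, $P^{(\omega,n)}_t$ is self-adjoint on $L^2(\Lambda_n,\lambda_n)$. (2) For $x\in\Lambda_n$ there exist $\mathbb{P}$-measure preserving maps $T_x:\Omega\to\Omega$ such that for every $S>0$ and all bounded measurable $F$ on $\mathcal{D}_S$, $E^x_{\omega,n}F(X)=E^0_{T_x\omega,n}F(X+x)$ and $\mathbb{E}E^0_{T_x\omega,n}F(X)=\mathbb{E}E^0_{\omega,n}F(X)$. (3) For every $S>0$ and every bounded continuous $F$ on $\mathcal{D}_S$, $\mathbb{E}E^0_{\omega,n}F(X)\to E_{BM}F(W)$ as $n\to\infty$. *)

(* Defs.v *)
From HB Require Import structures.
From mathcomp Require Import all_boot all_order all_algebra.
From mathcomp Require Import all_classical all_reals all_analysis.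
From mathcomp Require Import measurable_realfun.

Set Implicit Arguments.
Unset Strict Implicit.
Unset Printing Implicit Defensive.

Import Order.TTheory GRing.Theory Num.Theory.
Import numFieldNormedType.Exports.

Local Open Scope classical_set_scope.
Local Open Scope ring_scope.

Section borel_matrix.
Context {R : realType} {m n : nat}.

Definition matrix_borel_display : measure_display. Proof. exact. Qed.

Definition borel_matrix : set (set 'M[R]_(m, n)) := <<s open >>.

Let borel0 : borel_matrix set0. Proof. exact: sigma_algebra0. Qed.
Let borelC (A : set 'M[R]_(m, n)) : borel_matrix A -> borel_matrix (~` A).
Proof. by move=> mA; rewrite -setTD; exact: sigma_algebraCD. Qed.
Let borel_bigcup (F : (set 'M[R]_(m, n))^nat) :
  (forall i, borel_matrix (F i)) -> borel_matrix (\bigcup_i F i).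
Proof. exact: sigma_algebra_bigcup. Qed.

HB.instance Definition _ := @isMeasurable.Build matrix_borel_display
  'M[R]_(m, n) borel_matrix borel0 borelC borel_bigcup.

Lemma open_measurable_mx (A : set 'M[R]_(m, n)) : open A -> measurable A.
Proof. by move=> oA; exact: sub_sigma_algebra. Qed.

Lemma closed_measurable_mx (A : set 'M[R]_(m, n)) : closed A -> measurable A.
Proof.
move=> cA; rewrite -[A]setCK; apply: measurableC; apply: open_measurable_mx.
exact: closed_openC.
Qed.

Lemma measurable_set1_mx (x : 'M[R]_(m, n)) : measurable [set x].
Proof.
apply: closed_measurable_mx; apply: accessible_closed_set1.
exact/hausdorff_accessible/norm_hausdorff.
Qed.

Lemma measurable_coord_mx i j :
  measurable_fun [set: 'M[R]_(m, n)] (fun A => A i j : R).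
Proof.
apply: (measurability _ (RGenOpens.measurableE R)) => _ [_ [a [b ->]] <-].
rewrite setTI; apply: open_measurable_mx.
by apply: open_comp (@interval_open _ _ _ _ _) => // A _; exact: coord_continuous.
Qed.

End borel_matrix.

Lemma measurable_fun_mx d (T : measurableType d) (R : realType) m n
    (f : T -> 'M[R]_(m, n)) :
  (forall i j, measurable_fun [set: T] (fun t => f t i j : R)) ->
  measurable_fun [set: T] f.
Proof.
move=> mf; apply: (@measurability _ _ _ _ setT f open) => // _ [U oU <-].
rewrite setTI.
pose c (p : 'M[rat]_(m, n)) : 'M[R]_(m, n) := map_mx ratr p.
pose B (p : 'M[rat]_(m, n) * nat) :=
  if pselect (ball (c p.1) p.2.+1%:R^-1 `<=` U) then
    f @^-1` (ball (c p.1) p.2.+1%:R^-1) else set0.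
have -> : f @^-1` U = \bigcup_p B p.
  apply/seteqP; split => [t Ut|t [p _]]; last first.
    by rewrite /B; by case: pselect => // sU /= ht; exact: (sU _ ht).
  have /nbhs_ballP[e /= e0 eU] : nbhs (f t) U by exact: open_nbhs_nbhs.
  have [k ke] : exists k, k.+1%:R^-1 < e / 2.
    have e20 : 0 < e / 2 by rewrite divr_gt0.
    have [k _ /(_ k (leqnn k)) /= kP] := near_infty_natSinv_lt (PosNum e20).
    by exists k.
  have k0 : 0 < k.+1%:R^-1 :> R by [].
  have /choice[q qP] : forall ij : 'I_m * 'I_n,
      exists q : rat, `|ratr q - f t ij.1 ij.2| < k.+1%:R^-1.
    move=> ij.
    have [x [/= h [q _ qx]]] := @dense_rat R (ball (f t ij.1 ij.2) k.+1%:R^-1)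
      (ex_intro _ _ (ballxx _ k0)) (ball_open _ _).
    by exists q; rewrite qx distrC.
  exists (\matrix_(i, j) q (i, j), k) => //; rewrite /B /=.
  have hb : ball (c (\matrix_(i, j) q (i, j))) k.+1%:R^-1 (f t).
    by split => // i j; rewrite !mxE; exact: (qP (i, j)).
  case: pselect => // -[] v hv; apply: eU.
  apply: (@le_ball _ _ _ (k.+1%:R^-1 + k.+1%:R^-1)).
    by rewrite (splitr e) lerD ?ltW.
  exact: ball_triangle (ball_sym hb) hv.
apply: countable_bigcupT_measurable => [|p]; first exact: countableP.
rewrite /B; case: pselect => [sU|nU] /=; last exact: measurable0.
rewrite (_ : _ @^-1` _ = \bigcap_(ij in [set: 'I_m * 'I_n])
  ((fun t => f t ij.1 ij.2) @^-1` ball (c p.1 ij.1 ij.2) p.2.+1%:R^-1)); last first.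
  apply/seteqP; split => [t [_ h] ij _|t h]; first exact: h.
  by split=> // i j; exact: (h (i, j) I).
apply: fin_bigcap_measurable => [|ij _]; first exact: finite_finset.
rewrite -[X in measurable X]setTI; apply: mf => //.
by apply: open_measurable; exact: ball_open.
Qed.

Section lebesgue_rV.
Context {R : realType}.

Definition rV_cons n (p : measurableTypeR R * 'rV[R]_n) : 'rV[R]_n.+1 :=
  row_mx (const_mx p.1 : 'rV_1) p.2.

Lemma measurable_rV_cons n : measurable_fun [set: measurableTypeR R * 'rV[R]_n] (@rV_cons n).
Proof.
apply: measurable_fun_mx => i j; rewrite /rV_cons.
have [k kj|k kj] := fintype.splitP (j : 'I_(1 + n)).
  rewrite (_ : (fun p => _) = fst); first exact: measurable_fst.
  apply/funext => p; rewrite (_ : j = lshift n k); last exact: val_inj.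
  by rewrite [LHS](@row_mxEl _ 1 1 n) mxE.
rewrite (_ : (fun p => _) = (fun v : 'rV[R]_n => v i k) \o snd); last first.
  apply/funext => p; rewrite (_ : j = rshift 1 k); last exact: val_inj.
  by rewrite [LHS](@row_mxEr _ 1 1 n).
by apply: measurableT_comp => //; exact: measurable_coord_mx.
Qed.

HB.instance Definition _ n := isMeasurableFun.Build _ _ _ _ (@rV_cons n)
  (@measurable_rV_cons n).

Section step.
Context (n : nat) (mu : {sigma_finite_measure set 'rV[R]_n -> \bar R}).

Definition lebesgue_step : set 'rV[R]_n.+1 -> \bar R :=
  pushforward (@lebesgue_measure R \x mu)%E (@rV_cons n).

Local Notation push :=
  (pushforward (@lebesgue_measure R \x mu)%E (@rV_cons n)).

Let step0 : lebesgue_step set0 = 0%E.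
Proof. by apply: (@measure0 _ _ _ push); exact: measurable_rV_cons. Qed.
Let step_ge0 A : (0 <= lebesgue_step A)%E.
Proof. by apply: (@measure_ge0 _ _ _ push); exact: measurable_rV_cons. Qed.
Let step_sigma_additive : semi_sigma_additive lebesgue_step.
Proof. by apply: (@measure_semi_sigma_additive _ _ _ push); exact: measurable_rV_cons. Qed.

HB.instance Definition _ := isMeasure.Build _ _ _ lebesgue_step
  step0 step_ge0 step_sigma_additive.

Let step_sigma_finite : sigma_finite setT lebesgue_step.
Proof.
have /sigma_finiteP[A [TA ndA Aoo]] := sigma_finiteT (@lebesgue_measure R).
have /sigma_finiteP[B [TB ndB Boo]] := sigma_finiteT mu.
pose F k := A k `*` B k.
have TF : setT = \bigcup_k F k.
  rewrite -setXTT TA TB predeqE => -[x y]; split.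
    move=> [/= [k _ Akx] [l _ Bly]]; exists (maxn k l) => //; split.
    - by move: x Akx; exact/subsetPset/ndA/leq_maxl.
    - by move: y Bly; exact/subsetPset/ndB/leq_maxr.
  by move=> [k _ []/= ? ?]; split; exists k.
have Foo k : measurable (F k) /\ ((@lebesgue_measure R \x mu) (F k) < +oo)%E.
  have [? ?] := Aoo k; have [? ?] := Boo k; split; first exact: measurableX.
  by rewrite product_measure1E// lte_mul_pinfty// ge0_fin_numE.
pose g (v : 'rV[R]_n.+1) : measurableTypeR R * 'rV[R]_n :=
  (v 0 0, rsubmx (v : 'rV_(1 + n))).
have mg : measurable_fun setT g.
  apply: measurable_fun_pair; first exact: measurable_coord_mx.
  apply: measurable_fun_mx => i j.
  rewrite (_ : (fun v => _) = (fun v : 'rV[R]_n.+1 => v i (rshift 1 j))).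
    exact: measurable_coord_mx.
  by apply/funext => v; rewrite mxE.
have gK p : g (rV_cons p) = p.
  case: p => x v; rewrite /g /rV_cons /= row_mxKr; congr pair.
  rewrite (_ : (0 : 'I_n.+1) = @lshift 1 n 0); last exact: val_inj.
  by rewrite [LHS](@row_mxEl _ 1 1 n) mxE.
exists (fun k => g @^-1` F k) => [|k].
  by rewrite -preimage_bigcup -TF preimage_setT.
have [mF Fk] := Foo k; split; first by rewrite -[X in measurable X]setTI; exact: mg.
rewrite /lebesgue_step /pushforward (_ : _ @^-1` _ = F k)//.
by apply/seteqP; split => p /=; rewrite gK.
Qed.

HB.instance Definition _ := Measure_isSigmaFinite.Build _ _ _ lebesgue_step
  step_sigma_finite.

End step.

(** [R^(n+1)] is identified with [R * R^n]; [R^0] is a point of mass one. *)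
Fixpoint lebesgue_rV n : {sigma_finite_measure set 'rV[R]_n -> \bar R} :=
  if n is n'.+1 then lebesgue_step (lebesgue_rV n') else \d_(0 : 'rV[R]_0).

End lebesgue_rV.

Section lattice.
Context {R : realType} {d : nat}.
Implicit Types (delta : R) (mu : {measure set 'rV[R]_d -> \bar R}).

Definition lattice delta : set 'rV[R]_d :=
  range (fun z : 'rV[int]_d => delta *: map_mx intr z).

Lemma measurable_lattice delta : measurable (lattice delta).
Proof.
apply: countable_measurable => [x|]; first exact: measurable_set1_mx.
exact: (sub_countable (card_image_le _ _)).
Qed.

Definition lattice_measure (c : {posnum R}) delta : set 'rV[R]_d -> \bar R :=
  mscale c%:num%:nng (mrestr counting (measurable_lattice delta)).

HB.instance Definition _ c delta := Measure.on (lattice_measure c delta).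

Definition vague_cvg (mu : nat -> {measure set 'rV[R]_d -> \bar R})
    (nu : {measure set 'rV[R]_d -> \bar R}) : Prop :=
  forall f : 'rV[R]_d -> R, continuous f -> compact (closure [set x | f x != 0]) ->
    \int[mu n]_x f x @[n --> \oo] --> \int[nu]_x f x.

(** [L^2(Lambda_n, lambda_n)] is [L^2(R^d, lambda_n)], as [lambda_n] is carried
    by [Lambda_n]; being an operator on [L^2(mu)] is part of the definition. *)
Definition self_adjoint_L2 mu (Op : ('rV[R]_d -> R) -> 'rV[R]_d -> R) : Prop :=
  forall f g, f \in Lfun mu 2%:E -> g \in Lfun mu 2%:E ->
    Op f \in Lfun mu 2%:E /\
    \int[mu]_x (Op f x * g x) = \int[mu]_x (f x * Op g x).

End lattice.

Section cadlag.
Context {R : realType} {d : nat}.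
Implicit Types (f : R -> 'rV[R]_d) (c : R -> R).

Definition cadlag f : Prop := forall t : R,
  f s @[s --> t^'+] --> f t /\ cvg (f s @[s --> t^'-]).

Lemma cadlag_cst (x : 'rV[R]_d) : cadlag (fun=> x).
Proof. by move=> t; split; [exact: cvg_cst|exact: is_cvg_cst]. Qed.

Lemma cadlag_shift f x : cadlag f -> cadlag (fun t => f t + x).
Proof.
move=> cf t; have [fr fl] := cf t; split; first exact: cvgD fr (cvg_cst _).
by apply: is_cvgD => //; exact: is_cvg_cst.
Qed.

Lemma cadlag_comp f c : cadlag f -> continuous c ->
  {homo c : s t / s <= t} -> cadlag (f \o c).
Proof.
move=> cf cc hc t; have [fr fl] := cf (c t); split => /=.
- have [[s ts cst]|h] := pselect (exists2 s, t < s & c s = c t).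
    apply: cvg_near_cst; near=> u; congr f; apply/le_anti/andP; split.
      by rewrite -cst; apply: hc; near: u; exact: nbhs_right_le.
    by apply: hc; near: u; exact: nbhs_right_ge.
  apply: cvg_comp fr => A /= /(cc t) cA.
  have {}cA : \forall u \near t^'+, c t < c u -> A (c u).
    by apply: cvg_within; exact: cA.
  near=> u; have tu : t < u by near: u; exact: nbhs_right_gt.
  have : c t < c u.
    by rewrite lt_neqAle hc ?ltW// andbT eq_sym; apply/eqP => e; apply: h; exists u.
  by near: u.
- have [[s ts cst]|h] := pselect (exists2 s, s < t & c s = c t).
    apply/cvg_ex; exists (f (c t)).
    apply: cvg_near_cst; near=> u; congr f; apply/le_anti/andP; split.
      by apply: hc; near: u; exact: nbhs_left_le.
    by rewrite -cst; apply: hc; near: u; exact: nbhs_left_ge.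
  move/cvg_ex : fl => [l fl]; apply/cvg_ex; exists l.
  apply: cvg_comp fl => A /= /(cc t) cA.
  have {}cA : \forall u \near t^'-, c u < c t -> A (c u).
    by apply: cvg_within; exact: cA.
  near=> u; have tu : u < t by near: u; exact: nbhs_left_lt.
  have : c u < c t.
    by rewrite lt_neqAle hc ?ltW// andbT; apply/eqP => e; apply: h; exists u.
  by near: u.
Unshelve. all: by end_near. Qed.

End cadlag.

(** [cadlag_path R d] is [D([0,oo[, R^d])], and [skorokhod d S] is
    [D([0,S], R^d)] for [S > 0].  To have functions defined on the whole of
    [R], a path is extended by its boundary values outside its time interval;
    as such an extension is unique, no information is added. *)

Definition clamp {R : realType} (S t : R) : R := Num.max 0 (Num.min t S).

Record cadlag_path (R : realType) (d : nat) := CadlagPath {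
  path_fun :> R -> 'rV[R]_d ;
  path_cadlag : cadlag path_fun ;
  path_frozen : forall t, path_fun (Num.max 0 t) = path_fun t }.

Record skorokhod (R : realType) (d : nat) (S : R) := Skorokhod {
  sk_fun :> R -> 'rV[R]_d ;
  sk_cadlag : cadlag sk_fun ;
  sk_frozen : forall t, sk_fun (clamp S t) = sk_fun t }.

Lemma clamp_continuous {R : realType} (S : R) : continuous (clamp S).
Proof.
move=> t; apply: (@continuous_max _ _ (fun=> 0) (fun t => Num.min t S)).
  exact: cvg_cst.
apply: (@continuous_min _ _ id (fun=> S)); [exact: cvg_id|exact: cvg_cst].
Qed.

Lemma clamp_homo {R : realType} (S : R) : {homo clamp S : s t / s <= t}.
Proof. by move=> s t st; apply: le_max2 => //; apply: le_min2. Qed.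

Lemma clamp_idem {R : realType} (S t : R) : clamp S (clamp S t) = clamp S t.
Proof.
rewrite /clamp; have [S0|S0] := leP S 0.
  have h u : Num.max 0 (Num.min u S) = 0.
    by apply/max_idPl; rewrite ge_min S0 orbT.
  by rewrite !h.
rewrite (_ : Num.min (Num.max _ _) _ = Num.max 0 (Num.min t S)).
  by rewrite maxA maxxx.
by apply/min_idPl; rewrite ge_max (ltW S0) ge_min lexx orbT.
Qed.

(** The sigma-algebras on the path spaces are those generated by the
    coordinate process; for [S > 0] the one on [skorokhod d S] is the Borel
    sigma-algebra of the Skorokhod topology defined below (a classical fact,
    not proved here). *)

Definition path_display : measure_display. Proof. exact. Qed.

Definition cylinders {R : realType} {d : nat} (T : Type) (X : T -> R -> 'rV[R]_d)
    (I : set R) : set (set T) :=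
  [set A | exists2 t, I t & exists2 B, measurable B & A = X ^~ t @^-1` B].

Section path_measurable.
Context {R : realType} {d : nat}.

HB.instance Definition _ := gen_eqMixin (cadlag_path R d).
HB.instance Definition _ := gen_choiceMixin (cadlag_path R d).
HB.instance Definition _ := isPointed.Build (cadlag_path R d)
  (@CadlagPath R d (fun=> 0) (cadlag_cst 0) (fun=> erefl)).

Let cyl := cylinders (@path_fun R d) setT.
Let cyl0 : <<s cyl >> set0. Proof. exact: sigma_algebra0. Qed.
Let cylC A : <<s cyl >> A -> <<s cyl >> (~` A).
Proof. by move=> mA; rewrite -setTD; exact: sigma_algebraCD. Qed.
Let cyl_bigcup (F : (set (cadlag_path R d))^nat) :
  (forall i, <<s cyl >> (F i)) -> <<s cyl >> (\bigcup_i F i).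
Proof. exact: sigma_algebra_bigcup. Qed.

HB.instance Definition _ := @isMeasurable.Build path_display
  (cadlag_path R d) <<s cyl >> cyl0 cylC cyl_bigcup.

End path_measurable.

Section skorokhod_measurable.
Context {R : realType} {d : nat} {S : R}.

HB.instance Definition _ := gen_eqMixin (skorokhod d S).
HB.instance Definition _ := gen_choiceMixin (skorokhod d S).
HB.instance Definition _ := isPointed.Build (skorokhod d S)
  (@Skorokhod R d S (fun=> 0) (cadlag_cst 0) (fun=> erefl)).

Let cyl := cylinders (@sk_fun R d S) setT.
Let cyl0 : <<s cyl >> set0. Proof. exact: sigma_algebra0. Qed.
Let cylC A : <<s cyl >> A -> <<s cyl >> (~` A).
Proof. by move=> mA; rewrite -setTD; exact: sigma_algebraCD. Qed.
Let cyl_bigcup (F : (set (skorokhod d S))^nat) :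
  (forall i, <<s cyl >> (F i)) -> <<s cyl >> (\bigcup_i F i).
Proof. exact: sigma_algebra_bigcup. Qed.

HB.instance Definition _ := @isMeasurable.Build path_display
  (skorokhod d S) <<s cyl >> cyl0 cylC cyl_bigcup.

End skorokhod_measurable.

Section path_operations.
Context {R : realType} {d : nat}.
Implicit Types S : R.

Let path_restr_cadlag S (w : cadlag_path R d) : cadlag (w \o clamp S).
Proof.
apply: cadlag_comp; first exact: path_cadlag.
- exact: clamp_continuous.
- exact: clamp_homo.
Qed.

Let path_restr_frozen S (w : cadlag_path R d) t :
  (w \o clamp S) (clamp S t) = (w \o clamp S) t.
Proof. by rewrite /= clamp_idem. Qed.

Definition path_restr S (w : cadlag_path R d) : skorokhod d S :=
  Skorokhod (path_restr_cadlag S w) (path_restr_frozen S w).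

Let sk_shift_frozen S (x : 'rV[R]_d) (w : skorokhod d S) t :
  w (clamp S t) + x = w t + x.
Proof. by rewrite sk_frozen. Qed.

Definition sk_shift S (x : 'rV[R]_d) (w : skorokhod d S) : skorokhod d S :=
  Skorokhod (cadlag_shift x (sk_cadlag w)) (sk_shift_frozen x w).

Lemma measurable_path_restr S :
  measurable_fun [set: cadlag_path R d] (path_restr S).
Proof.
apply: (@measurability _ _ _ _ setT (path_restr S)
  (cylinders (@sk_fun R d S) setT)) => // _ [_ [t _ [B mB ->]] <-].
rewrite setTI; apply: sub_sigma_algebra.
by exists (clamp S t) => //; exists B.
Qed.

HB.instance Definition _ S := isMeasurableFun.Build _ _ _ _ (path_restr S)
  (@measurable_path_restr S).

End path_operations.

Section skorokhod_topology.
Context {R : realType} {d : nat} {S : R}.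
Implicit Types (x y z : skorokhod d S) (e : R) (lam : R -> R).

Definition time_change lam : Prop :=
  {in `[0, S] &, {mono lam : s t / s <= t}} /\ lam @` `[0, S]%classic = `[0, S]%classic.

(** The open balls of the metric
    [inf_lam max (sup_t |lam t - t|) (sup_t |x t - y (lam t)|)]. *)
Definition skorokhod_ball x e y : Prop :=
  exists2 lam, time_change lam & exists2 e', e' < e &
    forall t, t \in `[0, S] -> `|lam t - t| <= e' /\ `|x t - y (lam t)| <= e'.

Let skorokhod_ball_center x e : 0 < e -> skorokhod_ball x e x.
Proof.
move=> e0; exists id; first by split=> //; rewrite image_id.
by exists 0 => // t _; rewrite !subrr !normr0.
Qed.

Let skorokhod_ball_sym x y e : skorokhod_ball x e y -> skorokhod_ball y e x.
Proof.
move=> [lam [lam_mono lam_im] [e' ee' xy]].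
have lamI t : t \in `[0, S] -> lam t \in `[0, S].
  move=> tS; have : (lam @` `[0, S]%classic) (lam t) by exists t.
  by rewrite lam_im.
have /choice[mu muP] : forall t, exists s, t \in `[0, S] ->
    s \in `[0, S] /\ lam s = t.
  move=> t; have [tS|] := boolP (t \in `[0, S]); last by exists 0.
  have : (lam @` `[0, S]%classic) t by rewrite lam_im.
  by move=> [s sS st]; exists s.
exists mu.
  split=> [s t sS tS|].
    by have [? {2}<-] := muP s sS; have [? {2}<-] := muP t tS; rewrite lam_mono.
  apply/seteqP; split => [_ [t tS <-]|t tS]; first by have [] := muP t tS.
  have ltS : lam t \in `[0, S] by exact: lamI.
  exists (lam t) => //; have [mS mE] := muP _ ltS.
  by apply/le_anti/andP; split; rewrite -lam_mono// mE.
exists e' => // t tS; have [sS st] := muP t tS.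
by have [] := xy _ sS; rewrite st distrC => ?; rewrite distrC.
Qed.

Let skorokhod_ball_triangle x y z e1 e2 :
  skorokhod_ball x e1 y -> skorokhod_ball y e2 z ->
  skorokhod_ball x (e1 + e2) z.
Proof.
move=> [lam [lam_mono lam_im] [a ae xy]] [mu [mu_mono mu_im] [b be yz]].
have lamI t : t \in `[0, S] -> lam t \in `[0, S].
  move=> tS; have : (lam @` `[0, S]%classic) (lam t) by exists t.
  by rewrite lam_im.
exists (mu \o lam).
  split=> [s t sS tS|]; first by rewrite /= mu_mono ?lamI// lam_mono.
  by rewrite -image_comp lam_im.
exists (a + b) => [|t tS]; first exact: ltrD.
have [l1 x1] := xy _ tS; have [l2 x2] := yz _ (lamI _ tS).
split; rewrite /=; first rewrite [a + b]addrC.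
  by rewrite (le_trans (ler_distD (lam t) _ _))// lerD.
by rewrite (le_trans (ler_distD (y (lam t)) _ _))// lerD.
Qed.

HB.instance Definition _ := hasNbhs.Build (skorokhod d S)
  (nbhs_ (entourage_ skorokhod_ball)).
HB.instance Definition _ := Nbhs_isPseudoMetric.Build R (skorokhod d S)
  erefl skorokhod_ball_center skorokhod_ball_sym skorokhod_ball_triangle erefl.

End skorokhod_topology.

Section weak_convergence.
Context {R : realType} {d : nat} {S : R}.

Definition weak_cvg (mu : nat -> probability (skorokhod d S) R)
    (nu : probability (skorokhod d S) R) : Prop :=
  forall F : skorokhod d S -> R, continuous F -> bounded_fun F ->
    \int[mu k]_w F w @[k --> \oo] --> \int[nu]_w F w.

(** As in Billingsley, the limits need not belong to the family. *)
Definition relatively_compact_laws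
    (Pi : set (probability (skorokhod d S) R)) : Prop :=
  forall mu : nat -> probability (skorokhod d S) R, (forall k, Pi (mu k)) ->
    exists phi : nat -> nat, {homo phi : i j / (i < j)%N} /\
      exists nu : probability (skorokhod d S) R, weak_cvg (mu \o phi) nu.

End weak_convergence.

Section processes.
Context {R : realType} {d : nat}.
Implicit Types (L : set 'rV[R]_d) (P : 'rV[R]_d -> probability (cadlag_path R d) R).

Definition path_expectation {S : R} (mu : probability (cadlag_path R d) R)
    (F : skorokhod d S -> R) : R :=
  \int[mu]_w F (path_restr S w).

Definition path_law (S : R) (mu : probability (cadlag_path R d) R) :
  probability (skorokhod d S) R := distribution mu (path_restr S).

(** The laws [P x] are meaningful for [x] in the state space [L] only;
    functions on [L] are extended by zero. *)
Definition semigroup L P (t : R) (f : 'rV[R]_d -> R) (x : 'rV[R]_d) : R :=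
  if x \in L then \int[P x]_w f (w t) else 0.

Record markov_process L P : Prop := MarkovProcess {
  markov_start : forall x, L x -> P x [set w : cadlag_path R d | w 0 = x] = 1%E ;
  markov_values : forall x, L x ->
    {ae P x, forall w : cadlag_path R d, forall t, 0 <= t -> L (w t)} ;
  markov_property : forall x s t (A : set (cadlag_path R d)) (f : 'rV[R]_d -> R),
    L x -> 0 <= s -> 0 <= t ->
    <<s cylinders (@path_fun R d) `[0, s]%classic >> A ->
    measurable_fun setT f -> bounded_fun f ->
    \int[P x]_(w in A) f (w (s + t)) =
    \int[P x]_(w in A) semigroup L P t f (w s) }.

(** The product rule for the whole family implies that for subfamilies, as
    some of the sets [B i] may be [setT]. *)
Definition mutually_independent disp (T : measurableType disp)
    (Q : probability T R) (I : finType) (X : I -> T -> R) : Prop :=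
  forall B : I -> set R, (forall i, measurable (B i)) ->
    Q (\bigcap_i (X i @^-1` B i)) = (\prod_i fine (Q (X i @^-1` B i)))%:E.

(** [Q] is the law of a standard Brownian motion in [R^d] started at [0]. *)
Record standard_brownian (Q : probability (cadlag_path R d) R) : Prop :=
  StandardBrownian {
  brownian_start : Q [set w : cadlag_path R d | w 0 = 0] = 1%E ;
  brownian_continuous : {ae Q, forall w : cadlag_path R d, continuous w} ;
  brownian_gaussian : forall (s t : R) (j : 'I_d) (B : set R),
    0 <= s -> s < t -> measurable B ->
    Q [set w : cadlag_path R d | B (w t 0 j - w s 0 j)] = normal_prob 0 (Num.sqrt (t - s)) B ;
  brownian_independent : forall (t : nat -> R) (k : nat),
    0 <= t 0%N -> nondecreasing_seq t ->
    mutually_independent Q (fun (ij : 'I_k * 'I_d) (w : cadlag_path R d) =>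
      w (t ij.1.+1) 0 ij.2 - w (t ij.1) 0 ij.2) }.

End processes.

Section probability_space.
Context {R : realType} {disp : measure_display} {Omega : measurableType disp}.
Variable Pr : probability Omega R.

Definition measure_preserving (T : Omega -> Omega) : Prop :=
  measurable_fun setT T /\ forall A, measurable A -> Pr (T @^-1` A) = Pr A.

Definition cvg_in_probability (Y : nat -> Omega -> R) (l : R) : Prop :=
  forall e : R, 0 < e ->
    Pr [set omega | e <= `|Y n omega - l|] @[n --> \oo] --> 0%E.

End probability_space.

(* Main.v *)
Require Import Defs.
From HB Require Import structures.
From mathcomp Require Import all_boot all_order all_algebra.
From mathcomp Require Import all_classical all_reals all_analysis.
From mathcomp Require Import measurable_realfun ring lra.

Set Implicit Arguments.
Unset Strict Implicit.
Unset Printing Implicit Defensive.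

Import Order.TTheory GRing.Theory Num.Theory.
Import numFieldNormedType.Exports.

Local Open Scope classical_set_scope.
Local Open Scope ring_scope.

(** Write E_omega for the quenched expectation of the process started at 0,
    and E for the expectation over the environment.

    The heart of the proof is that a functional h of finitely many positions
    has a quenched expectation of vanishing variance.  The square of E_omega h
    is the expectation of h(X) h(X') for two independent walks X and X' from 0.
    The transition matrix is symmetric, so X' can be run backwards, and X' and
    X together form a single walk which starts at the endpoint of X' and is at
    0 at its middle time ([visits_splice]).  Averaging over the environment, a
    translation brings the starting point to 0; summing over all pairs of
    trajectories, E (E_omega h)^2 becomes the annealed expectation of
    h(backward) h(forward), the displacements of a walk of double length seen
    from its position at the middle time ([annealed_square]).  This is an
    annealed quantity, and it converges to its Brownian counterpart, which
    factorizes into (E_BM h)^2 because the increments of Brownian motion are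
    independent, stationary and symmetric ([brownian_square]).  Since also
    E E_omega h -> E_BM h, the variance tends to 0 ([cvg_variance_walk]).

    To reach an arbitrary continuous F, let F_N(w) be the value of F at the
    step path that reads w on the grid of mesh T/N.  For fixed N the previous
    argument applies to F_N, while E E_omega |F - F_N| converges to
    E_BM |F - F_N| as n grows, and this is small for N large
    ([cvg_sampling_error]); so E |E_omega F - E_BM F| -> 0.

    Two facts about the Skorokhod space support this.  Evaluation at a time is
    continuous only at the paths that are continuous there, so the annealed
    convergence is first extended to functionals which are continuous at
    continuous paths ([cvg_annealed_mapping]); these functionals are squeezed
    between Lipschitz ones, and Brownian motion does not see the gap.  And the
    step paths that read a cadlag path on finer and finer grids converge to it
    in the Skorokhod topology ([near_discretize]); hence continuous functionals
    are measurable for the sigma-algebra generated by the coordinates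
    ([measurable_continuous_sk]). *)

(** * Bounded measurable functions, kernels and countable partitions *)

Section bounded_measurable.
Context {disp : measure_display} {T : measurableType disp} {R : realType}.
Variable mu : probability T R.
Implicit Types f g : T -> R.

Lemma bounded_fun_leP (U : Type) (f : U -> R) :
  bounded_fun f <-> exists M, forall x, `|f x| <= M.
Proof.
split=> [[M [_ /= fM]]|[M fM]]; first by exists (M + 1) => x; apply: (fM (M + 1)) => //;
  rewrite ltrDl.
by exists M; split; [exact: num_real|move=> r Mr x _; exact: le_trans (fM x) (ltW Mr)].
Qed.

Lemma integrable_bounded f : measurable_fun setT f -> bounded_fun f ->
  mu.-integrable setT (EFin \o f).
Proof.
by move=> mf bf; apply: measurable_bounded_integrable => //;
  rewrite -ge0_fin_numE ?fin_num_measure.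
Qed.

Lemma Rintegral_cstT (r : R) : \int[mu]_x r = r.
Proof. by rewrite Rintegral_cst//= probability_setT mulr1. Qed.

Lemma EFin_Rintegral_bounded f : measurable_fun setT f -> bounded_fun f ->
  (\int[mu]_x f x)%:E = (\int[mu]_x (f x)%:E)%E.
Proof.
by move=> mf bf; rewrite /Rintegral fineK//; apply: integrable_fin_num => //;
  exact: integrable_bounded.
Qed.

Lemma cvg_Rintegral_bounded (f_ : nat -> T -> R) f (M : R) :
  (forall n, measurable_fun setT (f_ n)) -> measurable_fun setT f ->
  (forall n x, `|f_ n x| <= M) ->
  {ae mu, forall x, f_ n x @[n --> \oo] --> f x} ->
  \int[mu]_x f_ n x @[n --> \oo] --> \int[mu]_x f x.
Proof.
move=> mf_ mf fM ff.
have mf_' n : measurable_fun setT (fun x => (f_ n x)%:E) by exact/measurable_EFinP.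
have mf' : measurable_fun setT (fun x => (f x)%:E) by exact/measurable_EFinP.
have ff' : {ae mu, forall x, setT x -> (f_ n x)%:E @[n --> \oo] --> (f x)%:E}.
  by apply: filterS ff => x h _; apply: cvg_EFin => //; exact: nearW.
have iM : mu.-integrable setT (cst M%:E : T -> \bar R).
  exact: finite_measure_integrable_cst.
have fM' : {ae mu, forall x n, setT x -> (`|(f_ n x)%:E| <= (cst M%:E : T -> \bar R) x)%E}.
  by apply: aeW => x n _; rewrite /= lee_fin.
have [intf _ h] := dominated_convergence measurableT mf_' mf' ff' iM fM'.
by apply: fine_cvg; rewrite fineK//; exact: integrable_fin_num.
Qed.

End bounded_measurable.

Section product_integral.
Context {d1 d2 : measure_display} {T1 : measurableType d1}
  {T2 : measurableType d2} {R : realType}.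
Variables (mu : probability T1 R) (nu : probability T2 R).
Local Open Scope ereal_scope.

Lemma integral_prod_mul (f : T1 -> R) (g : T2 -> R) :
  measurable_fun setT f -> measurable_fun setT g ->
  (forall x, 0 <= f x)%R -> (forall y, 0 <= g y)%R ->
  \int[mu \x nu]_z (f z.1 * g z.2)%:E =
  \int[mu]_x (f x)%:E * \int[nu]_y (g y)%:E.
Proof.
move=> mf mg f0 g0; rewrite fubini_tonelli1/=; last 2 first.
- apply/measurable_EFinP; apply: measurable_funM; exact: measurableT_comp.
- by move=> z; rewrite lee_fin mulr_ge0.
rewrite /fubini_F -ge0_integralZr//; last 3 first.
- exact/measurable_EFinP.
- by move=> x _; rewrite lee_fin.
- by apply: integral_ge0 => y _; rewrite lee_fin.
apply: eq_integral => x _; rewrite -ge0_integralZl_EFin//.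
- by move=> y _; rewrite lee_fin.
- exact/measurable_EFinP.
Qed.

End product_integral.

Section countable_partition.
Context {disp : measure_display} {T : measurableType disp} {R : realType}.
Variable mu : {measure set T -> \bar R}.
Local Open Scope ereal_scope.

(** [pickle_inv], unlike [unpickle], reaches every index exactly once. *)
Definition countable_sum (I : countType) (a : I -> \bar R) : \bar R :=
  \sum_(k <oo) oapp a 0 (@pickle_inv I k).

(** Turns the expectation of a function of a walk on the lattice into a sum
    over trajectories. *)
Lemma integral_countable_partition (I : countType) (A : I -> set T)
    (c : I -> R) (f : T -> R) :
  (forall i, measurable (A i)) -> trivIset setT A ->
  {ae mu, forall x, exists i, A i x} ->
  measurable_fun setT f -> (forall x, 0 <= f x)%R -> (forall i, 0 <= c i)%R ->
  (forall i x, A i x -> f x = c i) ->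
  \int[mu]_x (f x)%:E = countable_sum (fun i => (c i)%:E * mu (A i)).
Proof.
move=> mA tA covA mf f0 c0 fc.
pose B k := oapp A set0 (@pickle_inv I k).
have mB k : measurable (B k) by rewrite /B; case: pickle_inv => //=; exact: measurable0.
have tB : trivIset setT B.
  apply/trivIsetP => i j _ _; rewrite /B.
  have := @pickle_invK I i; have := @pickle_invK I j.
  case: (@pickle_inv I i) => [x|] /=; case: (@pickle_inv I j) => [y|] /= yj xi ij;
    rewrite ?set0I ?setI0//.
  by move/trivIsetP : tA; apply => //; apply: contra ij => /eqP xy; rewrite -yj -xi xy.
have BE : \bigcup_k B k = \bigcup_i A i.
  apply/seteqP; split => [x [k _]|x [i _ Aix]].
    by rewrite /B; case: pickle_inv => //= i Aix; exists i.
  by exists (pickle i) => //; rewrite /B pickleK_inv.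
have mBU : measurable (\bigcup_k B k) by exact: bigcup_measurable.
have mBf : measurable_fun (\bigcup_k B k) (fun x => (f x)%:E).
  by apply/measurable_EFinP; exact: measurable_funTS.
rewrite (_ : \int[mu]_x _ = \int[mu]_(x in \bigcup_k B k) (f x)%:E); last first.
  rewrite [RHS]integral_mkcond; apply: ge0_ae_eq_integral => //.
  - exact/measurable_EFinP.
  - by rewrite -(measurable_restrictT (EFin \o f)).
  - by move=> x _; rewrite lee_fin.
  - by move=> x _; apply: erestrict_ge0 => y _; rewrite lee_fin.
  apply: filterS covA => x [i Aix] _; rewrite patchE mem_set// BE; by exists i.
rewrite ge0_integral_bigcup//; last by move=> x _; rewrite lee_fin.
apply: eq_eseriesr => k _; rewrite /B; case: pickle_inv => [i|] /=.
  rewrite -integral_cst//; apply: eq_integral => x /set_mem Aix.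
  by rewrite /= (fc i).
by rewrite integral_set0.
Qed.

End countable_partition.

Section integral_kernel.
Context {d1 d2 : measure_display} {T1 : measurableType d1}
  {T2 : measurableType d2} {R : realType}.
Variable k : T1 -> probability T2 R.
Hypothesis mk : forall A, measurable A -> measurable_fun setT (k ^~ A).

Lemma measurable_Rintegral_kernel (f : T2 -> R) :
  measurable_fun setT f -> bounded_fun f ->
  measurable_fun setT (fun x => \int[k x]_y f y).
Proof.
move=> mf /[dup] bf /bounded_fun_leP[M fM].
(* The shift by M makes the integrand nonnegative. *)
rewrite (_ : (fun x => _) = fun x => \int[k x]_y (f y + M) - M); last first.
  apply/funext => x; rewrite RintegralD//.
  - by rewrite Rintegral_cstT addrK.
  - exact: integrable_bounded.
  - by apply: integrable_bounded => //; apply/bounded_fun_leP; exists `|M|.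
apply: measurable_funB => //.
apply: (measurableT_comp (f := fine)) => //.
apply: (@measurable_fun_integral_kernel _ _ _ _ _ (fun x =>
  k x : {measure set T2 -> \bar R})) => //.
  by move=> z; have := fM z; rewrite ler_norml lee_fin -lerBlDr sub0r => /andP[].
by apply/measurable_EFinP; exact: measurable_funD.
Qed.

Lemma bounded_Rintegral_kernel (f : T2 -> R) :
  measurable_fun setT f -> bounded_fun f ->
  bounded_fun (fun x => \int[k x]_y f y).
Proof.
move=> mf /[dup] bf /bounded_fun_leP[M fM]; apply/bounded_fun_leP; exists M => x.
apply: le_trans (le_normr_Rintegral _ _) _ => //; first exact: integrable_bounded.
rewrite -[leRHS](Rintegral_cstT (k x)) le_Rintegral//.
- apply: integrable_bounded; first exact: measurableT_comp.
  by apply/bounded_fun_leP; exists M => y; rewrite normr_id.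
- by apply: integrable_bounded => //; apply/bounded_fun_leP; exists `|M|.
Qed.

End integral_kernel.

(** * Borel sets of matrices *)

Section matrix_boxes.
Context {R : realType} {m n : nat}.

Definition box (B : 'I_m -> 'I_n -> set R) : set 'M[R]_(m, n) :=
  [set M | forall i j, B i j (M i j)].

Definition boxes : set (set 'M[R]_(m, n)) :=
  [set A | exists2 B, (forall i j, measurable (B i j)) & A = box B].

Lemma measurable_box B : (forall i j, measurable (B i j)) -> measurable (box B).
Proof.
move=> mB.
rewrite (_ : box B = \bigcap_(ij in [set: 'I_m * 'I_n])
  ((fun M : 'M[R]_(m, n) => M ij.1 ij.2) @^-1` B ij.1 ij.2)); last first.
  by apply/seteqP; split => [M h ij _|M h i j]; [exact: h|exact: (h (i, j) I)].
apply: fin_bigcap_measurable => [|ij _]; first exact: finite_finset.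
by rewrite -[X in measurable X]setTI; apply: measurable_coord_mx.
Qed.

(** The coordinates are measurable for the sigma-algebra generated by the
    boxes, so the identity into the Borel sigma-algebra is. *)
Lemma measurable_boxesE : (measurable : set (set 'M[R]_(m, n))) = <<s boxes >>.
Proof.
apply/seteqP; split; last first.
  apply: smallest_sub; first exact: sigma_algebra_measurable.
  by move=> _ [B mB ->]; exact: measurable_box.
have mid : measurable_fun [set: g_sigma_algebraType boxes]
    (fun M : g_sigma_algebraType boxes => (M : 'M[R]_(m, n))).
  apply: measurable_fun_mx => i j _ B mB; rewrite setTI.
  apply: sub_sigma_algebra; exists (fun i' j' => if (i' == i) && (j' == j) then B else setT).
    by move=> i' j'; case: ifP => _ //; exact: measurableT.
  apply/seteqP; split => [M /= MB i' j'|M /(_ i j)]; last by rewrite !eqxx.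
  by case: ifP => // /andP[/eqP -> /eqP ->].
by move=> A mA; have := mid measurableT A mA; rewrite setTI.
Qed.

(** Dynkin: the boxes are stable under intersection and generate the Borel
    sets. *)
Lemma eq_probability_boxes (mu nu : {measure set 'M[R]_(m, n) -> \bar R}) :
  (mu setT < +oo)%E ->
  (forall B, (forall i j, measurable (B i j)) -> mu (box B) = nu (box B)) ->
  forall A, measurable A -> mu A = nu A.
Proof.
move=> mu1 munu A mA; apply: (@measure_unique _ _ _ boxes (fun=> setT)) => //.
- exact: measurable_boxesE.
- move=> _ _ [B mB ->] [C mC ->]; exists (fun i j => B i j `&` C i j).
    by move=> i j; exact: measurableI.
  by apply/seteqP; split => [M [hB hC] i j|M h]; [split|split => i j; case: (h i j)].
- by move=> _; exists (fun _ _ => setT) => //; apply/seteqP; split.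
- by rewrite bigcup_const.
- by move=> _ [B mB ->]; exact: munu.
Qed.

Lemma continuous_measurable_mx (h : 'M[R]_(m, n) -> R) :
  continuous h -> measurable_fun setT h.
Proof.
move=> ch; apply: (measurability _ (RGenOpens.measurableE R)) => _ [_ [a [b ->]] <-].
by rewrite setTI; apply: open_measurable_mx; apply: open_comp (@interval_open _ _ _ _ _).
Qed.

End matrix_boxes.

(** * Discretization of cadlag paths *)

Section step_paths.
Context {R : realType} {d : nat}.

Lemma truncn_left_const (u : R) :
  exists k, \forall v \near u^'-, Num.truncn v = k.
Proof.
have [ku|uk] := ltP (Num.truncn u)%:R u.
  exists (Num.truncn u); near=> v; apply/eqP; rewrite eqn_leq; apply/andP; split.
    by apply: le_truncn; near: v; exact: nbhs_left_le.
  rewrite -[leqLHS](@natrK R); apply: le_truncn; near: v; exact: nbhs_left_ge.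
case k0 : (Num.truncn u) uk => [|k] uk.
  exists 0%N; near=> v; apply/eqP; rewrite -leqn0 -k0; apply: le_truncn.
  by near: v; exact: nbhs_left_le.
have ku : k%:R < u.
  have : k.+1%:R <= u by rewrite -truncn_gt_nat k0.
  by apply: lt_le_trans; rewrite ltr_nat.
exists k; near=> v; apply/eqP; rewrite eqn_leq; apply/andP; split.
  rewrite truncn_le_nat; apply: lt_le_trans uk; near: v; exact: nbhs_left_lt.
rewrite -[leqLHS](@natrK R); apply: le_truncn; near: v; exact: nbhs_left_ge.
Unshelve. all: by end_near. Qed.

Lemma truncn_right_const (u : R) :
  \forall v \near u^'+, Num.truncn v = Num.truncn u.
Proof.
near=> v; apply/eqP; rewrite eqn_leq; apply/andP; split.
  by rewrite truncn_le_nat; near: v; apply: nbhs_right_lt; exact: truncnS_gt.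
by apply: le_truncn; near: v; exact: nbhs_right_ge.
Unshelve. all: by end_near. Qed.

Lemma cadlag_truncn (a : nat -> 'rV[R]_d) : cadlag (fun u => a (Num.truncn u)).
Proof.
move=> u; split.
  apply: cvg_near_cst; apply: filterS (truncn_right_const u) => v -> //.
have [k ku] := truncn_left_const u.
apply/cvg_ex; exists (a k); apply: cvg_near_cst.
by apply: filterS ku => v ->.
Qed.

Variable T : {posnum R}.

Let step_index (N : nat) t := clamp T%:num t * (N%:R / T%:num).

Let step_cadlag N (a : nat -> 'rV[R]_d) :
  cadlag (fun t => a (Num.truncn (step_index N t))).
Proof.
apply: (cadlag_comp (cadlag_truncn a)) => [t|s t st].
  by apply: cvgMl; exact: clamp_continuous.
by rewrite ler_wpM2r//; exact: clamp_homo.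
Qed.

Let step_frozen N (a : nat -> 'rV[R]_d) t :
  a (Num.truncn (step_index N (clamp T%:num t))) =
  a (Num.truncn (step_index N t)).
Proof. by rewrite /step_index clamp_idem. Qed.

(** The interval [0, T] is cut into N cells; at time T the index is N, so
    the values a 0, ..., a N matter. *)
Definition step_path N a : skorokhod d T%:num :=
  Skorokhod (step_cadlag N a) (step_frozen N a).

Definition grid N k : R := k%:R * (T%:num / N%:R).

Definition discretize N (w : R -> 'rV[R]_d) : skorokhod d T%:num :=
  step_path N (fun k => w (grid N k)).

Lemma clamp_id S t : 0 <= t <= S -> clamp S t = t :> R.
Proof.
by move=> /andP[t0 tS]; rewrite /clamp; move/min_idPl: tS => ->; apply/max_idPr.
Qed.

Lemma step_pathE N a i t : (0 < N)%N -> t <= T%:num ->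
  grid N i <= t < grid N i.+1 -> step_path N a t = a i.
Proof.
move=> N0 tT /andP[it ti]; rewrite /= /step_index.
have N0' : 0 < N%:R :> R by rewrite ltr0n.
have h0 : 0 < T%:num / N%:R by rewrite divr_gt0.
have i0 : 0 <= grid N i by rewrite mulr_ge0// ltW.
rewrite clamp_id ?tT ?(le_trans i0 it)//; congr a; apply: truncn_def.
have -> : N%:R / T%:num = (T%:num / N%:R)^-1 by rewrite invf_div.
by rewrite ler_pdivlMr// ltr_pdivrMr// it.
Qed.

Lemma grid_last N : (0 < N)%N -> grid N N = T%:num.
Proof. by move=> N0; rewrite /grid mulrC divfK// pnatr_eq0 -lt0n. Qed.

Lemma ball_step_path N (a b : nat -> 'rV[R]_d) e' e :
  0 <= e' -> e' < e -> (forall k, (k <= N)%N -> `|a k - b k| <= e') ->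
  ball (step_path N a) e (step_path N b).
Proof.
move=> e0 ee ab; exists id; first by split=> //; rewrite image_id.
exists e' => // t; rewrite in_itv/= => /andP[t0 tT]; rewrite subrr normr0; split=> //.
apply: ab; rewrite /step_index clamp_id ?t0//.
rewrite -ltnS truncn_lt_nat ?mulr_ge0//.
rewrite (@le_lt_trans _ _ (N%:R)) ?ltr_nat//.
by rewrite mulrA ler_pdivrMr// mulrC ler_wpM2l.
Qed.

End step_paths.

Section cadlag_partition.
Context {R : realType} {d : nat}.
Implicit Types (w : R -> 'rV[R]_d) (Q : R -> Prop).

(** Plays the part of a finite partition of [0, T] on whose cells w
    oscillates by at most e.  The supremum of the times reached by such
    cells is itself reached, because w has a left limit there, and it cannot
    be less than T, because w is right continuous there. *)
Lemma cadlag_induction w (T e : R) Q : cadlag w -> 0 < T -> 0 < e -> Q 0 ->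
  (forall a b : R, 0 <= a -> a < b -> b <= T -> Q a ->
    (forall s t : R, a <= s < b -> a <= t < b -> `|w s - w t| <= e) -> Q b) ->
  Q T.
Proof.
move=> cw T0 e0 Q0 QS.
have e20 : 0 < e / 2 by rewrite divr_gt0.
pose A : set R := [set a | 0 <= a <= T /\ Q a].
have A0 : A 0 by split=> //; rewrite lexx ltW.
have supA : has_sup A by split; [exists 0|exists T => a [/andP[]]].
pose c := sup A.
have c0 : 0 <= c by apply: (ub_le_sup supA.2).
have cT : c <= T by apply: ge_sup; [exists 0|move=> a [/andP[]]].
have osc (z : 'rV[R]_d) s t : `|w s - z| < e / 2 -> `|w t - z| < e / 2 -> `|w s - w t| <= e.
  move=> hs ht; rewrite (le_trans (ler_distD z _ _))// [leRHS]splitr lerD// ltW//.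
  by rewrite distrC.
have Qc : Q c.
  have [_ /cvg_ex[l lw]] := cw c.
  have : \forall s \near c^'-, `|w s - l| < e / 2.
    by have /cvgrPdist_lt/(_ _ e20) := lw; apply: filterS => s; rewrite distrC.
  move=> /nbhs_ballP[/= eta eta0 H].
  have [a [/andP[a0 aT] Qa] ca] := sup_adherent eta0 supA; rewrite -/c in ca.
  have := ub_le_sup supA.2 (conj (introT andP (conj a0 aT)) Qa : A a).
  rewrite -/c le_eqVlt => /predU1P[<-//|ac].
  apply: (QS a) => // s t /andP[as_ sc] /andP[at_ tc].
  apply: (osc l); apply: H => //.
  - by rewrite /ball/= ltr_distl; apply/andP; split; lra.
  - by rewrite /ball/= ltr_distl; apply/andP; split; lra.
have [//|cT'] := eqVneq c T.
  by move=> <-.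
have ltcT : c < T by rewrite lt_neqAle cT' cT.
have [rw _] := cw c.
have : \forall s \near c^'+, `|w s - w c| < e / 2.
  by have /cvgrPdist_lt/(_ _ e20) := rw; apply: filterS => s; rewrite distrC.
move=> /nbhs_ballP[/= eta eta0 H].
pose b := Num.min T (c + eta).
have cb : c < b by rewrite lt_min ltcT/= ltrDl.
have bT : b <= T by rewrite ge_min lexx.
suff : b <= c by rewrite leNgt cb.
apply: (ub_le_sup supA.2); split; first by rewrite bT andbT (le_trans c0)// ltW.
apply: (QS c) => // s t /andP[cs sb] /andP[ct tb].
have H' u : c <= u -> u < b -> `|w u - w c| < e / 2.
  rewrite le_eqVlt => /predU1P[<- _|cu ub]; first by rewrite subrr normr0.
  apply: H => //; rewrite /ball/= ltr_distl.
  by move: ub; rewrite /b lt_min => /andP[_ ?]; apply/andP; split; lra.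
by apply: (osc (w c)); exact: H'.
Qed.

End cadlag_partition.

Section discretization.
Context {R : realType} {d : nat} (T : {posnum R}).
Implicit Types (lam : R -> R) (w : skorokhod d T%:num).

(** The time changes from [0, a] to [0, a'], with the endpoints recorded, so
    that they can be extended beyond a. *)
Definition increasing_onto (a a' : R) lam :=
  [/\ forall s t, 0 <= s -> s < t -> t <= a -> lam s < lam t, lam 0 = 0, lam a = a' &
      forall u, 0 <= u <= a' -> exists2 t, 0 <= t <= a & lam t = u].

Lemma increasing_onto_itv a a' lam t : increasing_onto a a' lam ->
  0 <= t <= a -> 0 <= lam t <= a'.
Proof.
move=> [mlam lam0 <- _] /andP[t0 ta]; apply/andP; split.
  by move: t0; rewrite le_eqVlt => /predU1P[<-|t0]; rewrite ?lam0// -lam0 ltW// mlam.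
by move: ta; rewrite le_eqVlt => /predU1P[<-//|ta]; rewrite ltW// mlam.
Qed.

Lemma time_change_increasing_onto lam :
  increasing_onto T%:num T%:num lam -> time_change (S := T%:num) lam.
Proof.
move=> /[dup] lamT [mlam lam0 lamTT slam]; split.
  apply: le_mono_in => s t; rewrite !in_itv/= => /andP[s0 _] /andP[_ tT] st.
  exact: mlam.
apply/seteqP; split => [_ [t /= tT <-]|u /=].
  by move: tT; rewrite !in_itv/=; exact: increasing_onto_itv.
by rewrite in_itv/= => /slam[t tT <-]; exists t => //; rewrite /= in_itv.
Qed.

Definition extend_linearly (a b a' b' : R) lam (t : R) :=
  if t <= a then lam t else a' + (t - a) * ((b' - a') / (b - a)).

Lemma increasing_onto_extend a b a' b' lam : 0 <= a -> a < b -> a' < b' ->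
  increasing_onto a a' lam ->
  increasing_onto b b' (extend_linearly a b a' b' lam).
Proof.
move=> a0 ab ab' /[dup] lamaa [mlam lam0 lama slam]; rewrite /extend_linearly.
have r0 : 0 < (b' - a') / (b - a) by rewrite divr_gt0// subr_gt0.
split.
- move=> s t s0 st tb; case: (leP t a) => [ta|ta].
    by rewrite (le_trans (ltW st) ta) mlam.
  have lt_a' : a' < a' + (t - a) * ((b' - a') / (b - a)).
    by rewrite ltrDl mulr_gt0// subr_gt0.
  case: (leP s a) => sa.
    apply: le_lt_trans lt_a'.
    by have /andP[] := increasing_onto_itv lamaa (introT andP (conj s0 sa)).
  by rewrite ltrD2l ltr_pM2r// ltrD2r.
- by rewrite a0.
- by rewrite leNgt ab/= mulrC divfK ?subrKC// subr_eq0 gt_eqF.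
- move=> u /andP[u0 ub]; case: (leP u a') => ua.
    have [|t /andP[t0 ta] tu] := slam u; first by rewrite u0.
    by exists t; rewrite ?t0 ?(le_trans ta (ltW ab))// ta.
  exists (a + (u - a') / ((b' - a') / (b - a))).
    apply/andP; split; first by rewrite addr_ge0// divr_ge0 ?(ltW r0)// subr_ge0 ltW.
    rewrite -lerBrDl ler_pdivrMr// mulrC divfK ?subr_eq0 ?gt_eqF//.
    by rewrite lerD2r.
  rewrite leNgt ltrDl divr_gt0 ?subr_gt0//= addrAC subrr add0r divfK ?gt_eqF//.
  by rewrite subrKC.
Qed.

Lemma extend_linearlyE a b a' b' lam t : lam a = a' -> a <= t ->
  extend_linearly a b a' b' lam t = a' + (t - a) * ((b' - a') / (b - a)).
Proof.
rewrite /extend_linearly => la; rewrite le_eqVlt => /predU1P[<-|at_].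
  by rewrite lexx subrr mul0r addr0.
by rewrite leNgt at_.
Qed.

Lemma exists_grid_above N b : (0 < N)%N -> 0 <= b ->
  exists j, b <= grid T N j < b + T%:num / N%:R.
Proof.
move=> N0 b0; have h0 : 0 < T%:num / N%:R by rewrite divr_gt0// ltr0n.
have /andP[kb bk] := truncn_itv (divr_ge0 b0 (ltW h0)).
move: kb; rewrite le_eqVlt => /predU1P[kb|kb].
  exists (Num.truncn (b / (T%:num / N%:R))).
  by rewrite /grid kb divfK ?gt_eqF// lexx ltrDl.
exists (Num.truncn (b / (T%:num / N%:R))).+1; rewrite /grid.
rewrite ltr_pdivrMr// in bk; rewrite ltr_pdivlMr// in kb.
by rewrite ltW//= -natr1 mulrDl mul1r ltrD2r.
Qed.

Lemma grid_step N k : grid T N k.+1 = grid T N k + T%:num / N%:R.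
Proof. by rewrite /grid -natr1 mulrDl mul1r. Qed.

Lemma ltr_grid N i j : (0 < N)%N -> (grid T N i < grid T N j) = (i < j)%N.
Proof. by move=> N0; rewrite ltr_pM2r ?ltr_nat// divr_gt0// ltr0n. Qed.

Lemma ler_grid N i j : (0 < N)%N -> (grid T N i <= grid T N j) = (i <= j)%N.
Proof. by move=> N0; rewrite leNgt ltr_grid// -leqNgt. Qed.

Lemma grid_cell N t : (0 < N)%N -> 0 <= t ->
  exists i, grid T N i <= t < grid T N i.+1.
Proof.
move=> N0 t0; have h0 : 0 < T%:num / N%:R by rewrite divr_gt0// ltr0n.
have /andP[kb bk] := truncn_itv (divr_ge0 t0 (ltW h0)).
exists (Num.truncn (t / (T%:num / N%:R))).
by rewrite /grid -ler_pdivlMr// -ltr_pdivrMr// kb.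
Qed.

Lemma near_mesh (e : R) : 0 < e -> \forall N \near \oo, (0 < N)%N /\ T%:num / N%:R < e.
Proof.
move=> e0; near=> N.
have N0 : (0 < N)%N by near: N; exact: nbhs_infty_gt.
split=> //; rewrite ltr_pdivrMr ?ltr0n// mulrC -ltr_pdivrMr//.
near: N; exact: nbhs_infty_gtr.
Unshelve. all: by end_near. Qed.

(** Up to a, the path is close to its discretization after a time change
    that sends a to a grid point not before a.  The paths are not compared
    at a itself: a jump at a belongs to the next cell. *)
Definition discretized_upto w e N a := exists j lam,
  [/\ a <= grid T N j < a + T%:num / N%:R, increasing_onto a (grid T N j) lam &
      forall t, 0 <= t <= a -> `|lam t - t| <= T%:num / N%:R /\
        (t < a -> `|w t - discretize T N w (lam t)| <= e)].

(** The time change is extended linearly to [a, b].  At a time t in [a, b[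
    the discretization reads w at a grid point which again lies in [a, b[,
    where w oscillates little. *)
Lemma discretized_upto_extend w e N a b : (0 < N)%N -> 0 <= a -> b <= T%:num ->
  T%:num / N%:R < b - a ->
  (forall s t : R, a <= s < b -> a <= t < b -> `|w s - w t| <= e) ->
  discretized_upto w e N a -> discretized_upto w e N b.
Proof.
move=> N0 a0 bT hab osc [j [lam [/andP[aj ja] lamaj lamE]]].
have h0 : 0 < T%:num / N%:R by rewrite divr_gt0// ltr0n.
have ab : a < b by rewrite -subr_gt0 (lt_trans h0).
have [i /andP[bi ib]] := exists_grid_above N0 (le_trans a0 (ltW ab)).
have jb : grid T N j < b by lra.
have ji : grid T N j < grid T N i by exact: lt_le_trans bi.
exists i, (extend_linearly a b (grid T N j) (grid T N i) lam); split; first by rewrite bi.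
  exact: increasing_onto_extend.
move=> t /andP[t0 tb]; case: (ltP t a) => ta.
  have [] := lamE t; first by rewrite t0 ltW.
  by move=> h1 /(_ ta) h2; rewrite /extend_linearly (ltW ta).
have lama : lam a = grid T N j by case: lamaj.
rewrite extend_linearlyE//.
set th := (t - a) / (b - a).
have ba0 : 0 < b - a by rewrite subr_gt0.
have th0 : 0 <= th by rewrite divr_ge0 ?subr_ge0// ltW.
have th1 : th <= 1 by rewrite ler_pdivrMr// mul1r lerD2r.
have tE : t - a = th * (b - a) by rewrite divfK// gt_eqF.
have -> : (t - a) * ((grid T N i - grid T N j) / (b - a)) = th * (grid T N i - grid T N j).
  by rewrite /th mulrA mulrAC.
split.
  rewrite ger0_norm; last by nra.
  by nra.
move=> {}tb.
have th1' : th < 1 by rewrite ltr_pdivrMr// mul1r ltrD2r.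
set u := grid T N j + _.
have ju : grid T N j <= u by rewrite lerDl mulr_ge0// subr_ge0 ltW.
have ui : u < grid T N i by rewrite /u; nra.
have u0 : 0 <= u by apply: le_trans ju; apply: le_trans aj.
have [k /andP[ku uk]] := grid_cell N0 u0.
have jk : (j <= k)%N by rewrite -ltnS -(ltr_grid _ _ N0); exact: le_lt_trans uk.
have ki : (k < i)%N by rewrite -(ltr_grid _ _ N0); exact: le_lt_trans ui.
have iN : (i <= N)%N.
  rewrite -ltnS -(ltr_grid _ _ N0) grid_step grid_last//.
  by apply: lt_le_trans ib _; rewrite lerD2r.
have uT : u <= T%:num.
  by rewrite (le_trans (ltW ui))// -(grid_last T N0) ler_grid.
rewrite /discretize (step_pathE _ N0 uT (introT andP (conj ku uk))).
apply: osc; first by rewrite ta.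
rewrite (le_trans aj) ?ler_grid//=.
have : grid T N k.+1 <= grid T N i by rewrite ler_grid.
by rewrite grid_step; lra.
Qed.

Lemma near_discretize w e : 0 < e ->
  \forall N \near \oo, ball w e (discretize T N w).
Proof.
move=> e0; have e20 : 0 < e / 2 by rewrite divr_gt0.
have H : \forall N \near \oo, discretized_upto w (e / 2) N T%:num.
  apply: (@cadlag_induction _ _ w T%:num (e / 2)
    (fun a => \forall N \near \oo, discretized_upto w (e / 2) N a)) => //.
  - exact: sk_cadlag.
  - near=> N; have N0 : (0 < N)%N by near: N; exact: nbhs_infty_gt.
    exists 0%N, id; rewrite /grid mul0r; split.
    + by rewrite lexx add0r divr_gt0// ltr0n.
    + split=> // u /andP[u0 u1]; exists u => //; first by rewrite u0.
    + move=> t /andP[t0 t1]; rewrite subrr normr0 divr_ge0//; split=> // t2.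
      by move: (lt_le_trans t2 t0); rewrite ltxx.
  - move=> a b a0 ab bT Ha osc; near=> N.
    have [N0 hN] : (0 < N)%N /\ T%:num / N%:R < b - a.
      by near: N; apply: near_mesh; rewrite subr_gt0.
    by apply: (discretized_upto_extend N0 a0) => //; near: N.
near=> N.
have [j [lam [/andP[jT Tj] lamj lamE]]] : discretized_upto w (e / 2) N T%:num by near: N.
have [N0 hN] : (0 < N)%N /\ T%:num / N%:R < e / 2 by near: N; exact: near_mesh.
(* The first grid point not before T is T itself. *)
have jN : j = N.
  apply/eqP; rewrite eqn_leq -ltnS -(ltr_grid _ _ N0) -(ler_grid N j N0).
  by rewrite grid_step grid_last// Tj.
rewrite jN grid_last// in lamj.
exists lam; first exact: time_change_increasing_onto.
exists (e / 2); first by rewrite ltr_pdivrMr// ltr_pMr// ltr1n.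
move=> t; rewrite in_itv/= => /andP[t0 tT]; have [|h1 h2] := lamE t; first by rewrite t0.
split; first by rewrite (le_trans h1)// ltW.
move: tT; rewrite le_eqVlt => /predU1P[->|]; last exact: h2.
have -> : lam T%:num = T%:num by case: lamj.
have dT : discretize T N w T%:num = w T%:num.
  have gN := grid_last T N0.
  transitivity (w (grid T N N)); last by rewrite gN.
  by apply: (step_pathE (i := N) _ N0) => //; rewrite gN lexx -{1}gN ltr_grid/=.
by rewrite -[X in _ - X]/(discretize T N w T%:num) dT subrr normr0 ltW.
Unshelve. all: by end_near. Qed.

End discretization.

(** * Lipschitz minorants *)

Section lower_envelope.
Context {R : realType} {X : pseudoMetricType R}.
Variables (H : X -> R) (M : R).
Hypothesis HM : forall x, `|H x| <= M.

Let costs k x := [set r | exists y, exists2 e, 0 < e & ball x e y /\ r = H y + k%:R * e].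

(** The infimal convolution of H with k times the distance; balls stand for
    the distance. *)
Definition lower_envelope (k : nat) (x : X) : R := inf (costs k x).

Let lbH y : - M <= H y. Proof. by have := HM y; rewrite ler_norml => /andP[]. Qed.

Let costs_lbound k x : lbound (costs k x) (- M).
Proof.
move=> _ [y [e e0 [_ ->]]]; rewrite (le_trans (lbH y))// lerDl mulr_ge0// ltW//.
Qed.

Let costs_nonempty k x : costs k x !=set0.
Proof. by exists (H x + k%:R * 1), x, 1 => //; split => //; exact: ballxx. Qed.

Let costs_has_inf k x : has_inf (costs k x).
Proof. by split; [exact: costs_nonempty|exists (- M); exact: costs_lbound]. Qed.

Lemma lower_envelope_le_cost k x y e : 0 < e -> ball x e y ->
  lower_envelope k x <= H y + k%:R * e.
Proof. by move=> e0 xy; apply: ge_inf; [exact: (costs_has_inf k x).2|exists y, e]. Qed.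

Lemma lower_envelope_le k x : lower_envelope k x <= H x.
Proof.
apply/ler_addgt0Pr => e e0.
have e'0 : 0 < e / k.+1%:R by rewrite divr_gt0.
apply: le_trans (lower_envelope_le_cost k e'0 (ballxx _ e'0)) _.
by rewrite lerD2l mulrCA ger_pMr// ler_pdivrMr// mul1r ler_nat.
Qed.

Lemma lower_envelope_bounded k x : `|lower_envelope k x| <= M.
Proof.
rewrite ler_norml; apply/andP; split.
  by apply: lb_le_inf; [exact: costs_nonempty|exact: costs_lbound].
apply: le_trans (lower_envelope_le k x) _.
by have := HM x; rewrite ler_norml => /andP[].
Qed.

Lemma lower_envelope_lipschitz k x y e : 0 < e -> ball x e y ->
  lower_envelope k x <= lower_envelope k y + k%:R * e.
Proof.
move=> e0 xy; rewrite -lerBlDr; apply: lb_le_inf; first exact: costs_nonempty.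
move=> _ [z [e' e'0 [yz ->]]]; rewrite lerBlDr -addrA -mulrDr.
apply: lower_envelope_le_cost; first by rewrite addr_gt0.
by rewrite addrC; exact: ball_triangle xy yz.
Qed.

Lemma lower_envelope_continuous k : continuous (lower_envelope k).
Proof.
move=> x; apply/cvgrPdist_le => e e0.
have e'0 : 0 < e / k.+1%:R by rewrite divr_gt0.
have ke : k%:R * (e / k.+1%:R) <= e.
  by rewrite mulrCA ger_pMr// ler_pdivrMr// mul1r ler_nat.
apply/nbhs_ballP; exists (e / k.+1%:R) => //= y xy.
have h1 := lower_envelope_lipschitz k e'0 xy.
have h2 := lower_envelope_lipschitz k e'0 (ball_sym xy).
rewrite ler_distl; move: ke h1 h2; move: (_ * (_ / _)) => u ke h1 h2.
by apply/andP; split; lra.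
Qed.

(** Near x the values of H are close to H x; far from x the cost k e exceeds
    the oscillation of H once k is large. *)
Lemma lower_envelope_cvg x : H y @[y --> x] --> H x ->
  lower_envelope k x @[k --> \oo] --> H x.
Proof.
move=> /cvgrPdist_le cH; apply/cvgrPdist_le => e e0.
have /nbhs_ballP[/= r r0 xr] := cH _ e0.
have M0 : 0 <= M by exact: le_trans (HM x).
near=> k.
rewrite ger0_norm; last by rewrite subr_ge0 lower_envelope_le.
rewrite lerBlDr addrC -lerBlDr; apply: lb_le_inf; first exact: costs_nonempty.
move=> _ [y [e' e'0 [xy ->]]].
(* A competitor y close to x has H y close to H x; a distant one pays. *)
case: (ltP e' r) => er.
  have := xr _ (le_ball (ltW er) xy); rewrite ler_distl => /andP[h1 h2].
  have : 0 <= k%:R * e' by rewrite mulr_ge0// ltW.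
  by lra.
have hk : 2 * M <= k%:R * r.
  by rewrite -ler_pdivrMr//; near: k; exact: nbhs_infty_ger.
have : k%:R * r <= k%:R * e' by rewrite ler_wpM2l.
have := lbH y; have := HM x; rewrite ler_norml => /andP[_].
by lra.
Unshelve. all: by end_near. Qed.

End lower_envelope.

(** * Continuous functionals on the Skorokhod space *)

Section matrix_convergence.
Context {R : realType} {m n : nat}.

Lemma cvg_mx (U : Type) (F : set_system U) (FF : Filter F)
    (f : U -> 'M[R]_(m, n)) (M : 'M[R]_(m, n)) :
  (forall i j, f u i j @[u --> F] --> M i j) -> f u @[u --> F] --> M.
Proof.
move=> fM; apply/cvg_ballP => e e0.
have : \forall u \near F, forall ij : 'I_m * 'I_n, ball (M ij.1 ij.2) e (f u ij.1 ij.2).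
  by apply: filter_forall => ij; have /cvg_ballP := fM ij.1 ij.2; exact.
by apply: filterS => u h; split => // i j; exact: (h (i, j)).
Qed.

Lemma norm_mx_lt (M : 'M[R]_(m, n)) e : 0 < e ->
  (forall i j, `|M i j| < e) -> `|M| < e.
Proof.
move=> e0 h; have : ball (0 : 'M[R]_(m, n)) e M.
  by split=> // i j; rewrite /ball/= mxE sub0r normrN.
by rewrite mx_norm_ball /ball_/= sub0r normrN.
Qed.

End matrix_convergence.

Section skorokhod_functionals.
Context {R : realType} {d : nat}.

Lemma measurable_eval_path (t : R) :
  measurable_fun setT (fun w : cadlag_path R d => w t).
Proof.
by move=> _ B mB; rewrite setTI; apply: sub_sigma_algebra; exists t => //; exists B.
Qed.

Lemma measurable_eval_sk (S t : R) :
  measurable_fun setT (fun w : skorokhod d S => w t).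
Proof.
by move=> _ B mB; rewrite setTI; apply: sub_sigma_algebra; exists t => //; exists B.
Qed.

(** For general w this fails at the jumps of w. *)
Lemma continuous_eval_sk (S : R) (w : skorokhod d S) t : continuous w -> 0 <= t <= S ->
  v t @[v --> w] --> w t.
Proof.
move=> cw tS; apply/cvgrPdist_lt => e e0.
have e20 : 0 < e / 2 by rewrite divr_gt0.
have /cvgrPdist_lt/(_ _ e20)/nbhs_ballP[/= r r0 wr] := cw t.
apply/nbhs_ballP; exists (Num.min r (e / 2)); first by rewrite /= lt_min r0.
move=> v [lam [_ lamS] [e' ee' H]].
have : `[0, S]%classic t by rewrite /= in_itv.
rewrite -lamS => -[s /= sS st].
move: ee'; rewrite lt_min => /andP[er ee].
have [] := H s sS; rewrite st => ts wv.
rewrite (le_lt_trans (ler_distD (w s) _ _))// [ltRHS]splitr ltrD//.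
  by apply: wr; rewrite /ball/=; exact: le_lt_trans er.
exact: le_lt_trans ee.
Qed.

Lemma sk_ext (S : R) (x y : skorokhod d S) : (forall t, x t = y t) -> x = y.
Proof.
case: x y => [x cx fx] [y cy fy] /= /funext xy; rewrite xy in cx fx *.
by congr Skorokhod; exact: Prop_irrelevance.
Qed.

Lemma eq_step_path (T : {posnum R}) N (a b : nat -> 'rV[R]_d) :
  (forall k, (k <= N)%N -> a k = b k) -> step_path T N a = step_path T N b.
Proof.
move=> ab; apply: sk_ext => t /=; apply: ab.
have ct0 : 0 <= clamp T%:num t by rewrite /clamp le_max lexx.
have ctT : clamp T%:num t <= T%:num by rewrite /clamp ge_max ge_min lexx orbT andbT.
rewrite -ltnS truncn_lt_nat ?mulr_ge0//.
rewrite (@le_lt_trans _ _ (N%:R)) ?ltr_nat//.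
by rewrite mulrA ler_pdivrMr// mulrC ler_wpM2l.
Qed.

Definition matrix_path (T : {posnum R}) N (M : 'M[R]_(N.+1, d)) : skorokhod d T%:num :=
  step_path T N (fun k => row (inord k) M).

Lemma continuous_matrix_path T N : continuous (@matrix_path T N).
Proof.
move=> M A /nbhs_ballP[/= e e0 eA]; apply/nbhs_ballP.
have e20 : 0 < e / 2 by rewrite divr_gt0.
exists (e / 2) => //= M' [_ MM']; apply: eA.
apply: (@ball_step_path _ _ _ _ _ _ (e / 2)); first exact: ltW.
  by rewrite ltr_pdivrMr// ltr_pMr// ltr1n.
move=> k _; apply/ltW; apply: norm_mx_lt => // i j; rewrite !mxE.
exact: MM'.
Qed.

(** F is the pointwise limit of F composed with the discretizations, which
    are continuous functions of finitely many coordinates. *)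
Lemma measurable_continuous_sk (T : {posnum R}) (F : skorokhod d T%:num -> R) :
  continuous F -> measurable_fun setT F.
Proof.
move=> cF.
pose s N (w : skorokhod d T%:num) : 'M[R]_(N.+1, d) := \matrix_(i, j) w (grid T N i) 0 j.
have disc N (w : skorokhod d T%:num) : discretize T N w = matrix_path T (s N w).
  apply: eq_step_path => k kN; apply/rowP => j.
  by rewrite !mxE inordK.
apply: (measurable_fun_cvg (h := fun N (w : skorokhod d T%:num) => F (discretize T N w))) =>
  [N|w _].
  under eq_fun do rewrite disc.
  apply: (measurableT_comp (f := F \o @matrix_path T N)).
    apply: continuous_measurable_mx => M.
    by apply: continuous_comp; [exact: continuous_matrix_path|exact: cF].
  apply: measurable_fun_mx => i j; under eq_fun do rewrite mxE.
  apply: (measurableT_comp (f := fun v : 'rV[R]_d => v 0 j)).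
    exact: measurable_coord_mx.
  exact: measurable_eval_sk.
apply: (@cvg_comp _ _ _ (fun N => discretize T N w) F _ (nbhs w)); last exact: cF.
by move=> A /nbhs_ballP[/= e e0 eA]; apply: filterS (near_discretize w e0) => N; exact: eA.
Qed.

End skorokhod_functionals.

Lemma bounded_fun_comp (U V : Type) (R : realType) (f : V -> R) (g : U -> V) :
  bounded_fun f -> bounded_fun (f \o g).
Proof.
by move=> /bounded_fun_leP[M fM]; apply/bounded_fun_leP; exists M => x; exact: fM.
Qed.

(** * The mapping theorem for annealed laws *)

Section annealed_mapping.
Context {R : realType} {d : nat} {disp : measure_display}
  {Omega : measurableType disp}.
Variables (Pr : probability Omega R)
  (Q : nat -> Omega -> probability (cadlag_path R d) R)
  (BM : probability (cadlag_path R d) R).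
Hypothesis mQ : forall n A, measurable A ->
  measurable_fun setT (fun omega => Q n omega A).
Hypothesis BM_cont : {ae BM, forall w : cadlag_path R d, continuous w}.
Variable S : {posnum R}.
Implicit Types F G H : skorokhod d S%:num -> R.
Hypothesis annealed_cvg : forall F, continuous F -> bounded_fun F ->
  \int[Pr]_omega path_expectation (Q n omega) F @[n --> \oo] -->
  path_expectation BM F.

Lemma measurable_comp_restr F : measurable_fun setT F ->
  measurable_fun setT (fun w : cadlag_path R d => F (path_restr S%:num w)).
Proof. by move=> mF; apply: measurableT_comp => //; exact: measurable_path_restr. Qed.

Lemma measurable_path_expectation n F : measurable_fun setT F ->
  bounded_fun F -> measurable_fun setT (fun omega => path_expectation (Q n omega) F).
Proof.
move=> mF bF; apply: measurable_Rintegral_kernel; first exact: mQ.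
- exact: measurable_comp_restr.
- exact: (bounded_fun_comp (path_restr S%:num) bF).
Qed.

Lemma bounded_path_expectation n F : measurable_fun setT F ->
  bounded_fun F -> bounded_fun (fun omega => path_expectation (Q n omega) F).
Proof.
move=> mF bF; apply: bounded_Rintegral_kernel.
- exact: measurable_comp_restr.
- exact: (bounded_fun_comp (path_restr S%:num) bF).
Qed.

Lemma le_path_expectation (mu : probability (cadlag_path R d) R) F G :
  measurable_fun setT F -> bounded_fun F ->
  measurable_fun setT G -> bounded_fun G -> (forall w, F w <= G w) ->
  path_expectation mu F <= path_expectation mu G.
Proof.
move=> mF bF mG bG FG; apply: le_Rintegral => //.
- apply: integrable_bounded; first exact: measurable_comp_restr.
  exact: (bounded_fun_comp (path_restr S%:num) bF).
- apply: integrable_bounded; first exact: measurable_comp_restr.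
  exact: (bounded_fun_comp (path_restr S%:num) bG).
Qed.

Lemma le_annealed n F G :
  measurable_fun setT F -> bounded_fun F ->
  measurable_fun setT G -> bounded_fun G -> (forall w, F w <= G w) ->
  \int[Pr]_omega path_expectation (Q n omega) F <=
  \int[Pr]_omega path_expectation (Q n omega) G.
Proof.
move=> mF bF mG bG FG; apply: le_Rintegral => //.
- apply: integrable_bounded; first exact: measurable_path_expectation.
  exact: bounded_path_expectation.
- apply: integrable_bounded; first exact: measurable_path_expectation.
  exact: bounded_path_expectation.
- by move=> omega _; exact: le_path_expectation.
Qed.

(** The Lipschitz minorants of H are continuous, and their Brownian
    expectations converge to that of H because Brownian paths are
    continuous. *)
Lemma cvg_annealed_lower H : measurable_fun setT H -> bounded_fun H ->
  (forall w : skorokhod d S%:num, continuous w -> H v @[v --> w] --> H w) ->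
  forall e, 0 < e -> \forall n \near \oo,
    path_expectation BM H - e <= \int[Pr]_omega path_expectation (Q n omega) H.
Proof.
move=> mH /[dup] bH /bounded_fun_leP[M HM] cH e e0.
pose F := lower_envelope H.
have cF k : continuous (F k) by exact: (@lower_envelope_continuous _ _ H M HM k).
have mF k : measurable_fun setT (F k) by exact: measurable_continuous_sk.
have bF k : bounded_fun (F k).
  by apply/bounded_fun_leP; exists M => w; exact: (@lower_envelope_bounded _ _ H M HM).
have FH : path_expectation BM (F k) @[k --> \oo] --> path_expectation BM H.
  apply: (@cvg_Rintegral_bounded _ _ _ _ _ _ M).
  - by move=> k; exact: measurable_comp_restr.
  - exact: measurable_comp_restr.
  - by move=> k w; exact: (@lower_envelope_bounded _ _ H M HM).
  - apply: filterS BM_cont => w cw; apply: (lower_envelope_cvg HM); apply: cH.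
    move=> t; apply: continuous_comp; [exact: clamp_continuous|exact: cw].
have e20 : 0 < e / 2 by rewrite divr_gt0.
have [k Hk] : exists k, path_expectation BM H - e / 2 <= path_expectation BM (F k).
  have /cvgrPdist_le/(_ _ e20)[k _ /(_ k (leqnn k))] := FH.
  by rewrite ler_distl => /andP[_ h]; exists k; rewrite lerBlDr.
have /cvgrPdist_le/(_ _ e20) := annealed_cvg (cF k) (bF k).
apply: filterS => n; rewrite ler_distl => /andP[_ h].
apply: le_trans (le_annealed n (mF k) (bF k) mH bH _); first lra.
by move=> w; exact: (@lower_envelope_le _ _ H M HM).
Qed.

Lemma bounded_funN (U : Type) (f : U -> R) : bounded_fun f -> bounded_fun (fun x => - f x).
Proof.
by move=> /bounded_fun_leP[M fM]; apply/bounded_fun_leP; exists M => x; rewrite normrN.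
Qed.

Lemma path_expectationN (mu : probability (cadlag_path R d) R) F :
  measurable_fun setT F -> bounded_fun F ->
  path_expectation mu (fun w => - F w) = - path_expectation mu F.
Proof.
move=> mF bF; rewrite /path_expectation; under eq_Rintegral do rewrite -mulN1r.
rewrite RintegralZl ?mulN1r//; apply: integrable_bounded; first exact: measurable_comp_restr.
exact: (bounded_fun_comp (path_restr S%:num) bF).
Qed.

Lemma annealedN n F : measurable_fun setT F -> bounded_fun F ->
  \int[Pr]_omega path_expectation (Q n omega) (fun w => - F w) =
  - \int[Pr]_omega path_expectation (Q n omega) F.
Proof.
move=> mF bF; under eq_Rintegral do rewrite path_expectationN// -mulN1r.
rewrite RintegralZl ?mulN1r//; apply: integrable_bounded.
  exact: measurable_path_expectation.
exact: bounded_path_expectation.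
Qed.

(** Apply the lower bound to H and to its opposite. *)
Lemma cvg_annealed_mapping H : measurable_fun setT H -> bounded_fun H ->
  (forall w : skorokhod d S%:num, continuous w -> H v @[v --> w] --> H w) ->
  \int[Pr]_omega path_expectation (Q n omega) H @[n --> \oo] -->
  path_expectation BM H.
Proof.
move=> mH bH cH; apply/cvgrPdist_le => e e0.
have lo := cvg_annealed_lower mH bH cH e0.
have mNH : measurable_fun setT (fun w => - H w) by exact: measurable_funN.
have cNH (w : skorokhod d S%:num) : continuous w -> - H v @[v --> w] --> - H w.
  by move=> cw; apply: (@cvgN _ _ _ (nbhs w) _ H (H w)); exact: cH.
have up := cvg_annealed_lower mNH (bounded_funN bH) cNH e0.
near=> n.
have h1 : path_expectation BM H - e <= \int[Pr]_omega path_expectation (Q n omega) H.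
  by near: n.
have h2 : path_expectation BM (fun w => - H w) - e <=
    \int[Pr]_omega path_expectation (Q n omega) (fun w => - H w) by near: n.
rewrite path_expectationN// annealedN// in h2.
rewrite ler_distl; apply/andP; split; lra.
Unshelve. all: by end_near. Qed.

End annealed_mapping.

(** * The walk on the lattice and its reversal *)

Section lattice_points.
Context {R : realType} {d : nat}.
Variable delta : R.
Hypothesis delta_gt0 : 0 < delta.

Definition site {m n} (z : 'M[int]_(m, n)) : 'M[R]_(m, n) :=
  delta *: map_mx intr z.

Lemma site_inj m n : injective (@site m n).
Proof.
move=> x y /(scalerI (lt0r_neq0 delta_gt0)) /matrixP xy; apply/matrixP => i j.
by have := xy i j; rewrite !mxE => /eqP; rewrite eqr_int => /eqP.
Qed.

Lemma siteB m n (x y : 'M[int]_(m, n)) : site (x - y) = site x - site y.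
Proof. by rewrite /site map_mxB scalerBr. Qed.

Lemma site0 m n : site (0 : 'M[int]_(m, n)) = 0.
Proof. by rewrite /site map_mx0 scaler0. Qed.

Lemma lattice_site (z : 'rV[int]_d) : lattice delta (site z).
Proof. by exists z. Qed.

Lemma latticeP (x : 'rV[R]_d) : lattice delta x <-> exists z, x = site z.
Proof. by split=> [[z _ <-]|[z ->]]; exists z. Qed.

Variable c : {posnum R}.
Local Notation mu := (lattice_measure (d := d) c delta).

Lemma lattice_measure_site (z : 'rV[int]_d) : mu [set site z] = c%:num%:E.
Proof.
rewrite /lattice_measure /mscale /= /mrestr.
rewrite (_ : _ `&` _ = [set site z]); last first.
  by rewrite setIidl// => _ ->; exact: lattice_site.
rewrite /counting/=; case: asboolP => [_|]; last by have := @finite_set1 _ (site z).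
by rewrite fset_set1 [size _]finmap.cardfs1 mule1.
Qed.

Lemma Rintegral_lattice_indic (k : R) (z : 'rV[int]_d) :
  \int[mu]_x (k * \1_[set site z] x) = k * c%:num.
Proof.
have mz := measurable_set1_mx (site z).
rewrite RintegralZl//; first last.
  apply/integrableP; split; first by apply/measurable_EFinP; exact: measurable_indic.
  under eq_integral do rewrite gee0_abs ?lee_fin//.
  by rewrite integral_indic// setIT/= lattice_measure_site ltry.
by rewrite /Rintegral integral_indic// setIT/= lattice_measure_site.
Qed.

Lemma Lfun_lattice_indic (z : 'rV[int]_d) :
  (\1_[set site z] : 'rV[R]_d -> R) \in Lfun mu 2%:E.
Proof.
have mz := measurable_set1_mx (site z).
apply/andP; split; rewrite inE/=; first exact: measurable_indic.
rewrite /finite_norm unlock/=; apply: poweR_lty.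
have sqE (x : 'rV[R]_d) : `|\1_[set site z] x| `^ 2 = \1_[set site z] x :> R.
  by rewrite indicE; case: (_ \in _); rewrite /= ?normr1 ?normr0 ?powR1 ?powR0.
under eq_integral do rewrite sqE.
by rewrite integral_indic// setIT/= lattice_measure_site ltry.
Qed.

End lattice_points.

Section reversible_chain.
Context {R : realType} {d : nat}.
Variables (delta : R) (c : {posnum R}) (s : R).
Hypotheses (delta_gt0 : 0 < delta) (s_ge0 : 0 <= s).
Variable P : 'rV[R]_d -> probability (cadlag_path R d) R.
Hypothesis P_markov : markov_process (lattice delta) P.
Hypothesis P_sym :
  self_adjoint_L2 (lattice_measure c delta) (semigroup (lattice delta) P s).
Local Notation site := (site delta).
Implicit Types (x y z : 'rV[int]_d) (a : nat -> 'rV[int]_d).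

Definition transition x y : R :=
  fine (P (site x) [set w : cadlag_path R d | w s = site y]).

Definition visits a N : set (cadlag_path R d) :=
  [set w : cadlag_path R d | forall i, (i <= N)%N -> w (i%:R * s) = site (a i)].

Lemma measurable_eval_eq (t : R) (v : 'rV[R]_d) :
  measurable [set w : cadlag_path R d | w t = v].
Proof.
rewrite (_ : [set _ | _] = (fun w : cadlag_path R d => w t) @^-1` [set v])//.
by rewrite -[X in measurable X]setTI; apply: measurable_eval_path => //;
  exact: measurable_set1_mx.
Qed.

Lemma visitsS a N : visits a N.+1 =
  visits a N `&` [set w : cadlag_path R d | w (N.+1%:R * s) = site (a N.+1)].
Proof.
apply/seteqP; split => [w h|w [h hN] i]; first by split=> [i iN|]; apply: h => //; exact: leqW.
by rewrite leq_eqVlt => /predU1P[->//|]; rewrite ltnS; exact: h.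
Qed.

Lemma visits_adapted a N (S : R) : N%:R * s <= S ->
  <<s cylinders (@path_fun R d) `[0, S]%classic >> (visits a N).
Proof.
pose G := cylinders (@path_fun R d) `[0, S]%classic.
have mG (i : nat) : i%:R * s <= S -> <<s G >> [set w : cadlag_path R d | w (i%:R * s) = site
  (a i)].
  move=> iS; apply: sub_sigma_algebra; exists (i%:R * s).
    by rewrite /= in_itv/= mulr_ge0.
  by exists [set site (a i)] => //; exact: measurable_set1_mx.
elim: N => [|N ih] NS.
  rewrite (_ : visits a 0 = [set w : cadlag_path R d | w (0%:R * s) = site (a 0)]).
    exact: mG.
  by apply/seteqP; split => [w h|w h [|i]//]; exact: h.
rewrite visitsS; apply: (@measurableI _ (g_sigma_algebraType G)); last exact: mG.
by apply: ih; apply: le_trans NS; rewrite ler_wpM2r// ler_nat.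
Qed.

Lemma measurable_visits a N : measurable (visits a N).
Proof.
elim: N => [|N ih].
  rewrite (_ : visits a 0 = [set w : cadlag_path R d | w (0%:R * s) = site (a 0)]).
    exact: measurable_eval_eq.
  by apply/seteqP; split => [w h|w h [|i]//]; exact: h.
by rewrite visitsS; apply: measurableI => //; exact: measurable_eval_eq.
Qed.

Lemma semigroup_site x y :
  semigroup (lattice delta) P s \1_[set site y] (site x) = transition x y.
Proof.
rewrite /semigroup mem_set; last exact: lattice_site.
rewrite /Rintegral /transition -[X in P _ X]setIT -integral_indic//.
exact: measurable_eval_eq.
Qed.

(** Self-adjointness, tested on the indicators of two points. *)
Lemma transition_sym x y : transition x y = transition y x.
Proof.
have [_] := P_sym (Lfun_lattice_indic delta c y) (Lfun_lattice_indic delta c x).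
under eq_Rintegral => z _.
  rewrite (_ : _ * _ = transition x y * \1_[set site x] z); first over.
  rewrite !indicE; case: (boolP (z \in _)) => [/set_mem ->|_]; last by rewrite !mulr0.
  by rewrite -semigroup_site.
rewrite Rintegral_lattice_indic.
under eq_Rintegral => z _.
  rewrite (_ : _ * _ = transition y x * \1_[set site y] z); first over.
  rewrite !indicE; case: (boolP (z \in _)) => [/set_mem ->|_]; last by rewrite mulr0 mul0r.
  by rewrite mul1r mulr1 -semigroup_site.
by rewrite Rintegral_lattice_indic => /mulIf; apply.
Qed.

(** One application of the Markov property per step. *)
Lemma visits_prob a N : P (site (a 0%N)) (visits a N) =
  (\prod_(i < N) transition (a i) (a i.+1))%:E.
Proof.
elim: N => [|N ih].
  rewrite big_ord0 -(markov_start P_markov (lattice_site delta (a 0%N))); congr (P _ _).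
  apply/seteqP; split => [w /(_ 0%N)|w h [|i]//]; first by rewrite mul0r; exact.
  by rewrite mul0r.
have := markov_property P_markov (f := \1_[set site (a N.+1)]) (lattice_site delta (a 0%N))
  (mulr_ge0 (ler0n _ N) s_ge0) s_ge0 (visits_adapted a (lexx _)).
have mf : measurable_fun [set: 'rV[R]_d] (\1_[set site (a N.+1)] : 'rV[R]_d -> R).
  by apply: measurable_indic; exact: measurable_set1_mx.
have bf : bounded_fun (\1_[set site (a N.+1)] : 'rV[R]_d -> R).
  by apply/bounded_fun_leP; exists 1 => z; rewrite indicE; case: (_ \in _);
    rewrite ?normr1 ?normr0.
move=> /(_ mf bf).
have mV := measurable_visits a N.
have -> : \int[P (site (a 0))]_(w in visits a N) \1_[set site (a N.+1)] (w (N%:R * s + s))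
    = fine (P (site (a 0%N)) (visits a N.+1)).
  rewrite visitsS setIC -integral_indic//; last exact: measurable_eval_eq.
  congr fine; apply: eq_integral => w _; rewrite !indicE; congr (_%:R%:E).
  by rewrite -natr1 mulrDl mul1r.
have -> : \int[P (site (a 0))]_(w in visits a N)
      semigroup (lattice delta) P s \1_[set site (a N.+1)] (w (N%:R * s))
    = \int[P (site (a 0))]_(w in visits a N) (transition (a N) (a N.+1)).
  apply: eq_Rintegral => w /set_mem wN.
  by rewrite wN// semigroup_site.
rewrite Rintegral_cst// => E.
rewrite -[LHS]fineK; last by rewrite fin_num_measure//; exact: measurable_visits.
by rewrite E /= ih big_ord_recr/= mulrC.
Qed.

(** The trajectory a1 backwards, from time N to time 0, followed by a2. *)
Definition splice a1 a2 N i := if (i <= N)%N then a1 (N - i)%N else a2 (i - N)%N.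

(** As the transition matrix is symmetric, the first walk may be run
    backwards; followed by the second, it is one walk of double length. *)
Lemma visits_splice a1 a2 N : a1 0%N = a2 0%N ->
  (P (site (a1 0%N)) (visits a1 N) * P (site (a2 0%N)) (visits a2 N))%E =
  P (site (splice a1 a2 N 0%N)) (visits (splice a1 a2 N) (N + N)).
Proof.
move=> a12; rewrite !visits_prob -EFinM; congr EFin.
rewrite big_split_ord/=; congr (_ * _).
  rewrite (reindex_inj rev_ord_inj)/=; apply: eq_bigr => i _.
  rewrite /splice (ltnW (ltn_ord i)) (ltn_ord i) transition_sym; congr transition.
  by rewrite -subSn// subSS.
apply: eq_bigr => i _; rewrite /splice -addnS -[X in (_ <= X)%N]addn0 leq_add2l.
rewrite leqn0 (_ : (N + i.+1 <= N)%N = false); last first.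
  by apply/negbTE; rewrite -ltnNge -[X in (X < _)%N]addn0 ltn_add2l.
rewrite !addKn; case: eqP => [->|//].
by rewrite addn0 subnn a12.
Qed.

End reversible_chain.

(** * Second moments of quenched expectations *)

Section increments.
Context {R : realType} {d : nat}.
Variables (s : R) (N : nat).
Implicit Types (w : R -> 'rV[R]_d) (tau : nat -> nat).

(** With tau = id these are the displacements of the walk from its origin;
    with tau = addn N and tau = subn N, those of the future and of the past
    seen from time N s. *)
Definition increments tau w : 'M[R]_(N, d) :=
  \matrix_(k, j) (w ((tau k.+1)%:R * s) 0 j - w ((tau 0%N)%:R * s) 0 j).

(** The positions of a walk from 0 with prescribed displacements; beyond N
    the value is a dummy. *)
Definition trajectory (x : 'M[int]_(N, d)) (k : nat) : 'rV[int]_d :=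
  if k is k'.+1 then oapp (fun i => row i x) 0 (insub k') else 0.

Lemma trajectoryS x (k : 'I_N) : trajectory x k.+1 = row k x.
Proof. by rewrite /= valK. Qed.

Lemma increments_siteP delta tau w x :
  increments tau w = site delta x <->
  forall k, (k <= N)%N ->
    w ((tau k)%:R * s) - w ((tau 0%N)%:R * s) = site delta (trajectory x k).
Proof.
split=> [/matrixP h [_|k kN]|h]; first by rewrite subrr site0.
  rewrite -[k in RHS]/(nat_of_ord (Ordinal kN)) trajectoryS; apply/rowP => j.
  by have := h (Ordinal kN) j; rewrite !mxE/= => ->.
apply/matrixP => k j; have := h k.+1 (ltn_ord k); rewrite trajectoryS => /rowP/(_ j).
by rewrite !mxE.
Qed.

Lemma increments_lattice delta tau w : 0 <= s ->
  (forall t, 0 <= t -> lattice delta (w t)) ->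
  exists x, increments tau w = site delta x.
Proof.
move=> s0 wL.
have /choice[f fE] : forall k : 'I_N, exists z, w ((tau k.+1)%:R * s) - w ((tau 0%N)%:R * s)
  = site delta z.
  move=> k; have [|z1 e1] := (latticeP delta (w ((tau k.+1)%:R * s))).1.
    by apply: wL; rewrite mulr_ge0.
  have [|z2 e2] := (latticeP delta (w ((tau 0%N)%:R * s))).1.
    by apply: wL; rewrite mulr_ge0.
  by exists (z1 - z2); rewrite e1 e2 siteB.
exists (\matrix_(k, j) f k 0 j); apply/matrixP => k j.
by have /rowP/(_ j) := fE k; rewrite !mxE.
Qed.

Lemma measurable_increments tau :
  measurable_fun setT (fun w : cadlag_path R d => increments tau w).
Proof.
apply: measurable_fun_mx => k j; under eq_fun do rewrite mxE.
have m1 t : measurable_fun setT (fun w : cadlag_path R d => w t 0 j).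
  apply: (measurableT_comp (f := fun v : 'rV[R]_d => v 0 j)).
    exact: measurable_coord_mx.
  exact: measurable_eval_path.
exact: measurable_funB.
Qed.

End increments.

Section full_events.
Context {disp : measure_display} {T : measurableType disp} {R : realType}.
Variable mu : probability T R.

Lemma probability_setI_full A E : measurable A -> measurable E -> mu E = 1%E ->
  mu (A `&` E) = mu A.
Proof.
move=> mA mE E1; rewrite [RHS](measureDI _ mA mE)/=.
suff -> : mu (A `\` E) = 0%E by rewrite add0e.
apply/eqP; rewrite -measure_le0 (@le_trans _ _ (mu (~` E)))//.
  apply: le_measure; rewrite ?inE; [exact: measurableD|exact: measurableC|].
  by rewrite setDE; exact: subIsetr.
by rewrite probability_setC// E1 subee.
Qed.

Lemma eq_probability_full A B E : measurable A -> measurable B -> measurable E ->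
  mu E = 1%E -> A `&` E = B `&` E -> mu A = mu B.
Proof.
move=> mA mB mE E1 AB.
by rewrite -(probability_setI_full mA mE E1) AB probability_setI_full.
Qed.

Lemma ae_full E : measurable E -> mu E = 1%E -> {ae mu, forall x, E x}.
Proof.
move=> mE E1; exists (~` E); split; [exact: measurableC| |by move=> x].
by rewrite probability_setC// E1 subee.
Qed.

Lemma full_ae E : measurable E -> {ae mu, forall x, E x} -> mu E = 1%E.
Proof.
move=> mE [Z [mZ Z0 EZ]].
have E0 : mu (~` E) = 0%E.
  apply/eqP; rewrite -measure_le0 -Z0 le_measure ?inE//; exact: measurableC.
by rewrite -[E]setCK probability_setC ?E0 ?sube0//; exact: measurableC.
Qed.

Lemma integral_countable_sum (nu : {measure set T -> \bar R}) (I : countType)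
    (a : I -> T -> \bar R) :
  (forall i, measurable_fun setT (a i)) -> (forall i x, (0 <= a i x)%E) ->
  (\int[nu]_x countable_sum (a ^~ x) = countable_sum (fun i => \int[nu]_x a i x))%E.
Proof.
move=> ma a0; rewrite /countable_sum integral_nneseries//.
- apply: eq_eseriesr => k _; case: pickle_inv => //=.
  by rewrite integral0.
- by move=> k; case: pickle_inv => //=; exact: measurable_cst.
- by move=> k x _; case: pickle_inv => //=.
Qed.

End full_events.

Lemma indic_iff (T U : Type) (R : pzRingType) (A : set T) (B : set U) x y :
  (A x <-> B y) -> \1_A x = \1_B y :> R.
Proof.
move=> AB; rewrite !indicE; suff -> : (x \in A) = (y \in B) by [].
by apply/idP/idP => /set_mem h; apply/mem_set; apply/AB.
Qed.

Section two_sided_walk.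
Context {R : realType} {d : nat} {disp : measure_display}
  {Omega : measurableType disp}.
Variables (Pr : probability Omega R) (delta : R) (c : {posnum R}).
Variables (s : R) (N : nat).
Hypotheses (delta_gt0 : 0 < delta) (s_gt0 : 0 < s) (N_gt0 : (0 < N)%N).
Variable P : 'rV[R]_d -> Omega -> probability (cadlag_path R d) R.
Hypothesis P_measurable : forall x (A : set (cadlag_path R d)),
  lattice delta x -> measurable A ->
  measurable_fun [set: Omega] (fun omega => P x omega A).
Hypothesis P_markov : forall omega,
  markov_process (lattice delta) (fun x => P x omega).
Hypothesis P_sym : forall omega, self_adjoint_L2 (lattice_measure c delta)
  (semigroup (lattice delta) (fun x => P x omega) s).
Hypothesis P_stationary : forall x, lattice delta x ->
  exists2 Tx : Omega -> Omega, measure_preserving Pr Tx &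
  forall (S : R) (F : skorokhod d S -> R),
    0 < S -> measurable_fun setT F -> bounded_fun F ->
    (forall omega, path_expectation (P x omega) F =
       path_expectation (P 0 (Tx omega)) (fun w => F (sk_shift x w))) /\
    \int[Pr]_omega path_expectation (P 0 (Tx omega)) F =
    \int[Pr]_omega path_expectation (P 0 omega) F.
Local Notation site := (site delta).

Let s_ge0 : 0 <= s. Proof. exact: ltW. Qed.

Let sk_visits S (a : nat -> 'rV[int]_d) M : set (skorokhod d S) :=
  [set w | forall i, (i <= M)%N -> w (i%:R * s) = site (a i)].

Let measurable_sk_visits S a M : measurable (@sk_visits S a M).
Proof.
rewrite (_ : @sk_visits S a M =
  \bigcap_(i in [set i | (i <= M)%N]) [set w : skorokhod d S | w (i%:R * s) = site (a i)]);
    last first.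
  by apply/seteqP; split.
apply: bigcap_measurable => [|i _]; first by exists 0%N.
rewrite (_ : [set w | _] = (fun w : skorokhod d S => w (i%:R * s)) @^-1` [set site (a i)])//.
rewrite -[X in measurable X]setTI; apply: measurable_eval_sk => //.
exact: measurable_set1_mx.
Qed.

Lemma path_expectation_visits (mu : probability (cadlag_path R d) R)
    (S : R) a M : M%:R * s <= S ->
  path_expectation mu (\1_(@sk_visits S a M)) = fine (mu (visits delta s a M)).
Proof.
move=> MS; rewrite /path_expectation /Rintegral.
rewrite -[X in mu X]setIT -integral_indic//; last exact: measurable_visits.
congr fine; apply: eq_integral => w _; congr EFin; apply: indic_iff.
have iMS i : (i <= M)%N -> clamp S (i%:R * s) = i%:R * s.
  by move=> iM; rewrite clamp_id// mulr_ge0//= (le_trans _ MS)// ler_wpM2r// ler_nat.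
by split=> h i iM; rewrite -h//= iMS.
Qed.

(** Stationarity of the environment, applied to the indicator of a cylinder
    event. *)
Lemma annealed_visits_shift a z M : (0 < M)%N ->
  \int[Pr]_omega fine (P (site z) omega (visits delta s a M)) =
  \int[Pr]_omega fine (P 0 omega (visits delta s (fun i => a i - z) M)).
Proof.
move=> M0; have [Tx _ TxP] := P_stationary (lattice_site delta z).
have S0 : 0 < M%:R * s by rewrite mulr_gt0// ltr0n.
have mI b : measurable_fun setT (\1_(@sk_visits (M%:R * s) b M) : _ -> R).
  by apply: measurable_indic; exact: measurable_sk_visits.
have bI b : bounded_fun (\1_(@sk_visits (M%:R * s) b M) : _ -> R).
  by apply/bounded_fun_leP; exists 1 => w; rewrite indicE; case: (_ \in _);
    rewrite ?normr1 ?normr0.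
have [E1 _] := TxP _ _ S0 (mI a) (bI a).
have [_ E2] := TxP _ _ S0 (mI (fun i => a i - z)) (bI (fun i => a i - z)).
under eq_Rintegral do rewrite -(path_expectation_visits _ _ (lexx (M%:R * s))) E1.
under [RHS]eq_Rintegral do rewrite -(path_expectation_visits _ _ (lexx (M%:R * s))).
rewrite -E2; congr (Rintegral _ _ _); apply/funext => omega.
congr path_expectation; apply/funext => w; apply: indic_iff; split=> h i iM.
  by rewrite siteB -h//= addrK.
by rewrite /= h// siteB subrK.
Qed.

Local Notation walk := (increments (d := d) s N id).
Local Notation forward := (increments (d := d) s N (addn N)).
Local Notation backward := (increments (d := d) s N (subn N)).
Local Notation traj := (@trajectory d N).

Let start0 omega : P 0 omega [set w : cadlag_path R d | w 0 = 0] = 1%E.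
Proof. by apply: (markov_start (P_markov omega)); exists 0 => //; exact: site0. Qed.

Let measurable_increments_eq tau x :
  measurable [set w : cadlag_path R d | increments s N tau w = site x].
Proof.
rewrite -[X in measurable X]setTI;
  apply: (@measurable_increments R d s N tau measurableT [set site x]).
exact: measurable_set1_mx.
Qed.

Lemma walk_visits omega (x : 'M[int]_(N, d)) :
  P 0 omega [set w : cadlag_path R d | walk w = site x] =
  P 0 omega (visits delta s (traj x) N).
Proof.
apply: (eq_probability_full _ _ _ (start0 omega)).
- exact: measurable_increments_eq.
- exact: measurable_visits.
- exact: measurable_eval_eq.
apply/seteqP; split => w [/= h w0]; split => //.
  by move=> k kN; have := (increments_siteP _ _ _ _ _).1 h k kN; rewrite mul0r w0 subr0.
by apply/increments_siteP => k kN; rewrite h// mul0r w0 subr0.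
Qed.

(** As the walk starts at 0, its displacements seen from the middle time
    determine its position at that time, hence all its positions. *)
Lemma two_sided_visits omega (x y : 'M[int]_(N, d)) :
  P 0 omega ([set w : cadlag_path R d | backward w = site x] `&`
             [set w : cadlag_path R d | forward w = site y]) =
  P 0 omega (visits delta s
    (fun i => splice (traj x) (traj y) N i - traj x N) (N + N)).
Proof.
apply: (eq_probability_full _ _ _ (start0 omega)).
- by apply: measurableI; exact: measurable_increments_eq.
- exact: measurable_visits.
- exact: measurable_eval_eq.
apply/seteqP; split => w [/= h w0]; split => //.
  case: h => /increments_siteP hx /increments_siteP hy.
  rewrite subn0 in hx; rewrite addn0 in hy.
  have wN : w (N%:R * s) = - site (traj x N).
    by have := hx N (leqnn _); rewrite subnn mul0r w0 sub0r => <-; rewrite opprK.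
  move=> i iNN; rewrite siteB -wN /splice; case: leqP => iN.
    by rewrite -hx ?leq_subr// subKn// subrK.
  rewrite -hy; last by rewrite leq_subLR.
  by rewrite subnKC ?subrK// ltnW.
have wN : w (N%:R * s) = - site (traj x N).
  by rewrite h ?leq_addr// /splice leqnn subnn siteB site0 sub0r.
split; apply/increments_siteP => k kN.
  rewrite subn0 wN opprK h; last by rewrite (leq_trans (leq_subr _ _))// leq_addr.
  by rewrite /splice leq_subr subKn// siteB subrK.
rewrite addn0 wN opprK h ?leq_add2l// siteB subrK /splice.
rewrite addKn -[X in (_ <= X)%N]addn0 leq_add2l leqn0.
by case: eqP => [->|//]; rewrite addn0 subnn.
Qed.

(** By splicing and translation, a product of two quenched probabilities
    becomes, after averaging, a single annealed probability. *)
Lemma annealed_pair (x y : 'M[int]_(N, d)) :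
  \int[Pr]_omega fine (P 0 omega [set w : cadlag_path R d | walk w = site x] *
    P 0 omega [set w : cadlag_path R d | walk w = site y])%E =
  \int[Pr]_omega fine (P 0 omega
    ([set w : cadlag_path R d | backward w = site x] `&`
     [set w : cadlag_path R d | forward w = site y])).
Proof.
under [RHS]eq_Rintegral do rewrite two_sided_visits.
rewrite -annealed_visits_shift ?addn_gt0 ?N_gt0//.
apply: eq_Rintegral => omega _; rewrite !walk_visits.
rewrite -(site0 delta 1 d) -[0 in X in (X * _)%E]/(traj x 0) -[0 in X in (_ * X)%E]/(traj y 0).
rewrite (visits_splice (s_ge0) (P_markov omega) (P_sym omega))//.
by rewrite /splice leq0n subn0.
Qed.

Lemma integral_subprobability_fin_num (k : Omega -> \bar R) :
  measurable_fun setT k -> (forall omega, 0 <= k omega <= 1)%E ->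
  (\int[Pr]_omega k omega)%E \is a fin_num.
Proof.
move=> mk k01; rewrite ge0_fin_numE; last first.
  by apply: integral_ge0 => omega _; case/andP: (k01 omega).
apply: (@le_lt_trans _ _ (\int[Pr]_omega cst 1 omega)%E).
  by apply: ge0_le_integral => // omega _; case/andP: (k01 omega).
by rewrite integral_cst// mul1e -ge0_fin_numE ?fin_num_measure.
Qed.

Let site_measurable tau x omega : (0 <= P 0 omega [set w : cadlag_path R d | increments s N
  tau w = site x] <= 1)%E.
Proof. by rewrite measure_ge0 probability_le1//; exact: measurable_increments_eq. Qed.

Let lattice0 : lattice delta (0 : 'rV[R]_d).
Proof. by exists 0 => //; exact: site0. Qed.

Lemma annealed_pair_integral (x y : 'M[int]_(N, d)) :
  (\int[Pr]_omega (P 0 omega [set w : cadlag_path R d | walk w = site x] *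
    P 0 omega [set w : cadlag_path R d | walk w = site y]) =
  \int[Pr]_omega P 0 omega
    ([set w : cadlag_path R d | backward w = site x] `&`
     [set w : cadlag_path R d | forward w = site y]))%E.
Proof.
have m2 : measurable ([set w : cadlag_path R d | backward w = site x] `&`
     [set w : cadlag_path R d | forward w = site y]).
  by apply: measurableI; exact: measurable_increments_eq.
rewrite -[LHS]fineK; last first.
  apply: integral_subprobability_fin_num.
    by apply: emeasurable_funM; apply: P_measurable => //; exact: measurable_increments_eq.
  move=> omega; have /andP[x0 x1] := site_measurable id x omega.
  have /andP[y0 y1] := site_measurable id y omega.
  by rewrite mule_ge0//= -[leRHS]mule1 lee_pmul.
rewrite -[RHS]fineK; last first.
  apply: integral_subprobability_fin_num; first exact: P_measurable.
  by move=> omega; rewrite measure_ge0 probability_le1.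
congr EFin; have := annealed_pair x y; rewrite /Rintegral.
under eq_integral => omega _.
  rewrite fineK; first over.
  by rewrite fin_numM// fin_num_measure//; exact: measurable_increments_eq.
move=> ->; congr fine; apply: eq_integral => omega _.
by rewrite fineK// fin_num_measure.
Qed.

Section square.
Variable h : 'M[R]_(N, d) -> R.
Hypotheses (mh : measurable_fun setT h) (bh : bounded_fun h)
  (h_ge0 : forall M, 0 <= h M).
Let I := ('M[int]_(N, d) * 'M[int]_(N, d))%type.
Let hh (i : I) := h (site i.1) * h (site i.2).

Let hh_ge0 i : 0 <= hh i. Proof. exact: mulr_ge0. Qed.

Let mhi tau : measurable_fun setT (fun w : cadlag_path R d => h (increments s N tau w)).
Proof. by apply: measurableT_comp => //; exact: measurable_increments. Qed.

Let ae_site tau omega : {ae P 0 omega, forall w : cadlag_path R d,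
  exists x, increments s N tau w = site x}.
Proof.
have := markov_values (P_markov omega) lattice0.
by apply: filterS => w; exact: increments_lattice.
Qed.

Let measurable_walk_range :
  measurable [set w : cadlag_path R d | exists x, walk w = site x].
Proof.
rewrite (_ : [set w | _] = \bigcup_x [set w : cadlag_path R d | walk w = site x]).
  by apply: countable_bigcupT_measurable => // x; exact: measurable_increments_eq.
by apply/seteqP; split => [w [x wx]|w [x _ wx]]; exists x.
Qed.

(** Partition of the product space of two independent walks according to
    both trajectories. *)
Lemma walk_square omega :
  ((\int[P 0 omega]_w h (walk w)) ^+ 2)%:E =
  countable_sum (fun i : I => (hh i)%:E *
    (P 0 omega [set w : cadlag_path R d | walk w = site i.1] *
     P 0 omega [set w : cadlag_path R d | walk w = site i.2]))%E.
Proof.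
rewrite expr2 EFinM EFin_Rintegral_bounded//;
  last exact: (bounded_fun_comp (fun w : cadlag_path R d => walk w) bh).
rewrite -integral_prod_mul//.
pose A (i : I) := [set w : cadlag_path R d | walk w = site i.1] `*`
  [set w : cadlag_path R d | walk w = site i.2].
have mA i : measurable (A i) by apply: measurableX; exact: measurable_increments_eq.
rewrite (@integral_countable_partition _ _ _ _ I A hh) => //.
- congr countable_sum; apply/funext => i; rewrite /A /= product_measure1E//;
    exact: measurable_increments_eq.
- move=> [x y] [x' y'] _ _ [[w w'] [[/= wx wy] [/= wx' wy']]].
  by congr pair; apply: (site_inj delta_gt0); rewrite -?wx -?wy -?wx' -?wy'.
- pose E := [set w : cadlag_path R d | exists x, walk w = site x].
  have E1 : P 0 omega E = 1%E by apply: full_ae => //; exact: ae_site.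
  have mEE : measurable (E `*` E) by exact: measurableX.
  exists (~` (E `*` E)); split; first exact: measurableC.
    rewrite /= (product_subprobability_setC (P 0 omega : subprobability _ _, P 0 omega :
      subprobability _ _) mEE)/=.
    by rewrite -setXTT !product_measure1E//= E1 probability_setT subee// mule1.
  move=> [w w'] /= nA [[x wx] [y wy]]; apply: nA; exists (x, y); split => //.
- apply: measurable_funM.
    exact: (measurableT_comp (mhi id) (measurable_fst)).
  exact: (measurableT_comp (mhi id) (measurable_snd)).
- by move=> z; rewrite mulr_ge0.
- by move=> i [w w'] [/= -> ->].
Qed.

Lemma two_sided_integral omega :
  (\int[P 0 omega]_w (h (backward w) * h (forward w)))%:E =
  countable_sum (fun i : I => (hh i)%:E * P 0 omega
    ([set w : cadlag_path R d | backward w = site i.1] `&`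
     [set w : cadlag_path R d | forward w = site i.2]))%E.
Proof.
have mbf : measurable_fun setT (fun w : cadlag_path R d => h (backward w) * h (forward w)).
  exact: measurable_funM.
have bbf : bounded_fun (fun w : cadlag_path R d => h (backward w) * h (forward w)).
  have [M hM] := (bounded_fun_leP h).1 bh.
  by apply/bounded_fun_leP; exists (M * M) => w; rewrite normrM ler_pM.
rewrite EFin_Rintegral_bounded//.
rewrite (@integral_countable_partition _ _ _ _ I (fun i =>
  [set w : cadlag_path R d | backward w = site i.1] `&`
  [set w : cadlag_path R d | forward w = site i.2]) hh) => //.
- by move=> i; apply: measurableI; exact: measurable_increments_eq.
- move=> [x y] [x' y'] _ _ [w [[/= wx wy] [/= wx' wy']]].
  by congr pair; apply: (site_inj delta_gt0); rewrite -?wx -?wy -?wx' -?wy'.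
- apply: filterS2 (ae_site (subn N) omega) (ae_site (addn N) omega).
  by move=> w [x wx] [y wy]; exists (x, y).
- by move=> w; rewrite mulr_ge0.
- by move=> i w [/= -> ->].
Qed.

(** Summing [annealed_pair] over all pairs of trajectories. *)
Lemma annealed_square :
  \int[Pr]_omega ((\int[P 0 omega]_w h (walk w)) ^+ 2) =
  \int[Pr]_omega (\int[P 0 omega]_w (h (backward w) * h (forward w))).
Proof.
rewrite /Rintegral -!/(Rintegral _ _ _); congr fine.
under eq_integral do rewrite walk_square.
under [RHS]eq_integral do rewrite two_sided_integral.
have mP A : measurable A -> measurable_fun setT (fun omega => P 0 omega A).
  by move=> mA; exact: P_measurable.
have mI tau x := measurable_increments_eq tau x.
rewrite integral_countable_sum; last 2 first.
- by move=> i; apply: emeasurable_funM => //; apply: emeasurable_funM; exact: mP.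
- by move=> i omega; rewrite !mule_ge0// lee_fin.
rewrite integral_countable_sum; last 2 first.
- by move=> i; apply: emeasurable_funM => //; apply: mP; exact: measurableI.
- by move=> i omega; rewrite !mule_ge0// lee_fin.
congr countable_sum; apply/funext => i.
rewrite ge0_integralZl_EFin//; last by apply: emeasurable_funM; exact: mP.
rewrite ge0_integralZl_EFin//; last by apply: mP; exact: measurableI.
  by rewrite annealed_pair_integral.
by move=> omega _; rewrite mule_ge0.
Qed.

End square.

End two_sided_walk.

(** * Time reversal of Brownian increments *)

Section normal_symmetry.
Context {R : realType}.

Let measurable_opp :
  measurable_fun [set: measurableTypeR R] (-%R : measurableTypeR R -> measurableTypeR R).
Proof. exact: (@measurable_funN _ _ _ _ id). Qed.

Lemma lebesgue_measure_opp (A : set R) : measurable A ->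
  lebesgue_measure A = lebesgue_measure (-%R @^-1` A).
Proof.
move=> mA.
apply: (@lebesgue_measure_unique R (pushforward (@lebesgue_measure R)
  (-%R : measurableTypeR R -> measurableTypeR R))) => //.
move=> _ [[a b] _ <-] /=; rewrite /pushforward.
rewrite (_ : _ @^-1` _ = `[- b, - a[%classic); last first.
  by apply/seteqP; split => x /=; rewrite !in_itv/= lerNl ltrNr andbC.
by rewrite !lebesgue_measure_itv/= !lte_fin ltrN2; case: ifP => // _; rewrite -!EFinB opprK addrC.
Qed.

Lemma normal_prob_opp (sigma : R) (V : set R) : sigma != 0 -> measurable V ->
  normal_prob 0 sigma (-%R @^-1` V) = normal_prob 0 sigma V.
Proof.
move=> s0 mV; rewrite /normal_prob.
have mf : measurable_fun V (fun x => (normal_pdf 0 sigma x)%:E).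
  by apply/measurable_EFinP; apply: measurable_funTS; exact: measurable_normal_pdf.
have <- : (\int[pushforward (@lebesgue_measure R) (-%R : measurableTypeR R -> measurableTypeR
  R)]_(x in V)
    (normal_pdf 0 sigma x)%:E = \int[lebesgue_measure]_(x in V) (normal_pdf 0 sigma x)%:E)%E.
  apply: eq_measure_integral => A mA _; exact/esym/lebesgue_measure_opp.
rewrite ge0_integral_pushforward//; last by move=> x _; rewrite lee_fin normal_pdf_ge0.
apply: eq_integral => x _ /=; congr EFin.
by rewrite !normal_pdfE///= /normal_fun !subr0 sqrrN.
Qed.

End normal_symmetry.

Section law.
Context {d1 d2 : measure_display} {T1 : measurableType d1}
  {T2 : measurableType d2} {R : realType}.
Variables (mu : probability T1 R) (f : T1 -> T2).
Hypothesis mf : measurable_fun setT f.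

Let f_mixin := isMeasurableFun.Build _ _ _ _ _ mf.
Let f_pack : {mfun T1 >-> T2} := HB.pack f f_mixin.

(** Carries the measurability of f, which [distribution] expects bundled
    with f. *)
Definition law : probability T2 R := distribution mu f_pack.

Lemma ge0_integral_law (g : T2 -> R) : measurable_fun setT g ->
  (forall y, 0 <= g y) -> (\int[law]_y (g y)%:E = \int[mu]_x (g (f x))%:E)%E.
Proof.
move=> mg g0; rewrite ge0_integral_pushforward//.
- exact/measurable_EFinP.
- by move=> y _; rewrite lee_fin.
Qed.

End law.

Section brownian_increments.
Context {R : realType} {d : nat}.
Variables (BM : probability (cadlag_path R d) R) (s : R) (N : nat).
Hypotheses (BM_std : standard_brownian BM) (s_gt0 : 0 < s).

Definition steps n (w : R -> 'rV[R]_d) : 'M[R]_(n, d) :=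
  \matrix_(i, j) (w (i.+1%:R * s) 0 j - w (i%:R * s) 0 j).

Lemma measurable_coord_path t j :
  measurable_fun setT (fun w : cadlag_path R d => w t 0 j).
Proof.
apply: (measurableT_comp (f := fun v : 'rV[R]_d => v 0 j)).
  exact: measurable_coord_mx.
exact: measurable_eval_path.
Qed.

Lemma measurable_steps n :
  measurable_fun setT (fun w : cadlag_path R d => steps n w).
Proof.
apply: measurable_fun_mx => i j; under eq_fun do rewrite mxE.
by apply: measurable_funB; exact: measurable_coord_path.
Qed.

Local Notation gauss B := (fine (normal_prob 0 (Num.sqrt s) B)).

(** The rule that defines independence, together with the Gaussian
    marginals. *)
Lemma steps_box n (B : 'I_n -> 'I_d -> set R) :
  (forall i j, measurable (B i j)) ->
  BM [set w : cadlag_path R d | box B (steps n w)] =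
  (\prod_i \prod_j gauss (B i j))%:E.
Proof.
move=> mB; rewrite pair_big/=.
have := @brownian_independent _ _ _ BM_std (fun k => k%:R * s) n.
rewrite mul0r lexx => /(_ isT); have nd : nondecreasing_seq (fun k => k%:R * s).
  by move=> i j ij; rewrite ler_wpM2r ?ler_nat// ltW.
move=> /(_ nd (fun ij => B ij.1 ij.2) (fun ij => mB ij.1 ij.2)) => E.
rewrite (_ : [set w | _] = \bigcap_(ij in [set: 'I_n * 'I_d]) ((fun w : cadlag_path R d =>
      w (ij.1.+1%:R * s) 0 ij.2 - w (ij.1%:R * s) 0 ij.2) @^-1` B ij.1 ij.2)); last first.
  apply/seteqP; split => [w h ij _|w h i j]; last by rewrite mxE; exact: (h (i, j) I).
  by have := h ij.1 ij.2; rewrite mxE.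
rewrite E; congr EFin; apply: eq_bigr => ij _; congr fine.
have t0 : 0 <= ij.1%:R * s by rewrite mulr_ge0// ltW.
have lt_t : ij.1%:R * s < ij.1.+1%:R * s by rewrite ltr_pM2r// ltr_nat.
have := brownian_gaussian BM_std ij.2 t0 lt_t (mB ij.1 ij.2).
have sE : ij.1.+1%:R * s - ij.1%:R * s = s by rewrite -mulrBl -natrB// subSnn mul1r.
rewrite [X in Num.sqrt X]sE => <-; congr (BM _).
Qed.

Definition cumulate (M : 'M[R]_(N, d)) : 'M[R]_(N, d) :=
  \matrix_(k, j) \sum_(i < N | (i <= k)%N) M i j.

Lemma measurable_cumulate : measurable_fun setT cumulate.
Proof.
apply: measurable_fun_mx => i j; under eq_fun do rewrite mxE big_mkcond/=.
apply: measurable_sum => k; case: (k <= i)%N; first exact: measurable_coord_mx.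
exact: measurable_cst.
Qed.

(** The first N steps are reversed in time and in sign: they become the
    steps of the past, seen from time N s. *)
Definition reflect_steps (M : 'M[R]_(N + N, d)) : 'M[R]_(N + N, d) :=
  col_mx (\matrix_(i, j) - M (lshift N (rev_ord i)) j) (dsubmx M).

Lemma reflect_stepsEu M i j :
  reflect_steps M (lshift N i) j = - M (lshift N (rev_ord i)) j.
Proof. by rewrite col_mxEu mxE. Qed.

Lemma reflect_stepsEd M i j : reflect_steps M (rshift N i) j = M (rshift N i) j.
Proof. by rewrite col_mxEd mxE. Qed.

Lemma sum_le_ord (f : nat -> R) (k : 'I_N) :
  \sum_(i < N | (i <= k)%N) f i = \sum_(i < k.+1) f i.
Proof. by rewrite (big_ord_widen N f (ltn_ord k)). Qed.

Lemma cumulate_telescope (u : nat -> 'rV[R]_d) :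
  cumulate (\matrix_(i, j) (u i.+1 0 j - u i 0 j)) = \matrix_(k, j) (u k.+1 0 j - u 0%N 0 j).
Proof.
apply/matrixP => k j; rewrite !mxE; under eq_bigr do rewrite mxE.
rewrite (sum_le_ord (fun i => u i.+1 0 j - u i 0 j)).
by rewrite -(big_mkord xpredT (fun i => u i.+1 0 j - u i 0 j)) telescope_sumr.
Qed.

Lemma walk_steps w : increments s N id w = cumulate (steps N w).
Proof. by rewrite (cumulate_telescope (fun i => w (i%:R * s))); apply/matrixP => i j;
  rewrite !mxE. Qed.

Lemma forward_steps w :
  increments s N (addn N) w = cumulate (dsubmx (reflect_steps (steps (N + N) w))).
Proof.
rewrite col_mxKd (_ : dsubmx _ = \matrix_(i, j) (w ((N + i.+1)%:R * s) 0 j - w ((N + i)%:R *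
  s) 0 j)); last first.
  by apply/matrixP => i j; rewrite !mxE/= addnS.
by rewrite (cumulate_telescope (fun i => w ((N + i)%:R * s))); apply/matrixP => i j; rewrite !mxE.
Qed.

Lemma backward_steps w :
  increments s N (subn N) w = cumulate (usubmx (reflect_steps (steps (N + N) w))).
Proof.
rewrite col_mxKu (_ : \matrix_(i, j) _ = \matrix_(i, j) (w ((N - i.+1)%:R * s) 0 j - w ((N -
  i)%:R * s) 0 j)); last first.
  by apply/matrixP => i j; rewrite !mxE/= opprB subnSK.
by rewrite (cumulate_telescope (fun i => w ((N - i)%:R * s))); apply/matrixP => i j; rewrite !mxE.
Qed.

(** A centred normal law is symmetric, so the reflected steps are again
    independent with the same marginals. *)
Lemma reflect_steps_box (B : 'I_(N + N) -> 'I_d -> set R) :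
  (forall i j, measurable (B i j)) ->
  BM [set w : cadlag_path R d | box B (reflect_steps (steps (N + N) w))] =
  ((\prod_(i < N) \prod_j gauss (B (lshift N i) j)) *
   (\prod_(i < N) \prod_j gauss (B (rshift N i) j)))%:E.
Proof.
move=> mB.
have mopp (A : set R) : measurable A -> measurable (-%R @^-1` A).
  move=> mA; rewrite -[X in measurable X]setTI.
  by apply: (@measurable_funN _ _ _ _ id).
(* The boxes of the past are reflected, and their order is reversed. *)
pose B' (i : 'I_(N + N)) (j : 'I_d) := match fintype.split i with
  | inl k => -%R @^-1` B (lshift N (rev_ord k)) j
  | inr k => B (rshift N k) j end.
have mB' i j : measurable (B' i j).
  by rewrite /B'; case: (fintype.split i) => k //; exact: mopp.
rewrite (_ : [set w | _] = [set w : cadlag_path R d | box B' (steps (N + N) w)]).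
  rewrite steps_box// big_split_ord/=; congr (_ * _)%:E; last first.
    by apply: eq_bigr => i _; apply: eq_bigr => j _; rewrite /B' (unsplitK (inr i)).
  rewrite [RHS](reindex_inj rev_ord_inj)/=; apply: eq_bigr => i _; apply: eq_bigr => j _.
  rewrite /B' (unsplitK (inl i)) normal_prob_opp//.
  by rewrite gt_eqF// sqrtr_gt0.
have BE w : box B (reflect_steps (steps (N + N) w)) <-> box B' (steps (N + N) w).
  split=> h i j.
    rewrite /B' -[i in steps _ _ i _]splitK; case: (fintype.split i) => k /=.
      by have := h (lshift N (rev_ord k)) j; rewrite reflect_stepsEu rev_ordK.
    by have := h (rshift N k) j; rewrite reflect_stepsEd.
  rewrite -[i]splitK; case: (fintype.split i) => k /=.
    have := h (lshift N (rev_ord k)) j; rewrite /B' (unsplitK (inl _)) rev_ordK.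
    by rewrite reflect_stepsEu.
  have := h (rshift N k) j; rewrite /B' (unsplitK (inr _)).
  by rewrite reflect_stepsEd.
by apply/seteqP; split => w /= /BE.
Qed.

Definition glue_mx (p : 'M[R]_(N, d) * 'M[R]_(N, d)) : 'M[R]_(N + N, d) :=
  col_mx p.1 p.2.

Lemma measurable_glue_mx : measurable_fun setT glue_mx.
Proof.
apply: measurable_fun_mx => i j; rewrite /glue_mx -[i]splitK.
case: (fintype.split i) => k /=.
  under eq_fun do rewrite col_mxEu.
  by apply: (measurableT_comp (f := fun M : 'M[R]_(N, d) => M k j)) => //;
    exact: measurable_coord_mx.
under eq_fun do rewrite col_mxEd.
by apply: (measurableT_comp (f := fun M : 'M[R]_(N, d) => M k j)) => //;
  exact: measurable_coord_mx.
Qed.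

Lemma measurable_usubmx : measurable_fun setT (usubmx : 'M[R]_(N + N, d) -> 'M[R]_(N, d)).
Proof. by apply: measurable_fun_mx => i j; under eq_fun do rewrite mxE;
  exact: measurable_coord_mx. Qed.

Lemma measurable_dsubmx : measurable_fun setT (dsubmx : 'M[R]_(N + N, d) -> 'M[R]_(N, d)).
Proof. by apply: measurable_fun_mx => i j; under eq_fun do rewrite mxE;
  exact: measurable_coord_mx. Qed.

Lemma measurable_reflect_steps : measurable_fun setT reflect_steps.
Proof.
apply: measurable_fun_mx => i j; rewrite -[i]splitK.
case: (fintype.split i) => k /=.
  under eq_fun do rewrite reflect_stepsEu.
  by apply: measurable_funN; exact: measurable_coord_mx.
by under eq_fun do rewrite reflect_stepsEd; exact: measurable_coord_mx.
Qed.

Let mreflect : measurable_fun setT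
  (fun w : cadlag_path R d => reflect_steps (steps (N + N) w)).
Proof. by apply: measurableT_comp; [exact: measurable_reflect_steps|exact: measurable_steps]. Qed.

Local Notation mu := (law BM (measurable_steps (n := N))).

(** Past and future are independent copies of the first N steps. *)
Lemma reflect_steps_law (A : set 'M[R]_(N + N, d)) : measurable A ->
  law BM mreflect A = pushforward (mu \x mu)%E glue_mx A.
Proof.
move=> mA; apply: eq_probability_boxes => //.
- exact: measurable_glue_mx.
- by rewrite -ge0_fin_numE ?fin_num_measure.
move=> mglue B mB; rewrite [LHS]reflect_steps_box//= /pushforward.
rewrite (_ : _ @^-1` _ = box (fun i => B (lshift N i)) `*` box (fun i => B (rshift N i))).
  rewrite product_measure1E; [|exact: measurable_box..].
  by rewrite EFinM -!steps_box.
apply/seteqP; split => [[M M'] /= h|[M M'] /= [hM hM'] i j].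
  split=> i j; first by have := h (lshift N i) j; rewrite col_mxEu.
  by have := h (rshift N i) j; rewrite col_mxEd.
rewrite -[i]splitK; case: (fintype.split i) => k /=.
  by rewrite col_mxEu; exact: hM.
by rewrite col_mxEd; exact: hM'.
Qed.

(** Past and future displacements are the same function of independent
    copies of the steps. *)
Lemma brownian_square (h : 'M[R]_(N, d) -> R) :
  measurable_fun setT h -> bounded_fun h -> (forall M, 0 <= h M) ->
  \int[BM]_w (h (increments s N (subn N) w) * h (increments s N (addn N) w)) =
  (\int[BM]_w h (increments s N id w)) ^+ 2.
Proof.
move=> mh bh h0; pose g := h \o cumulate.
have mg : measurable_fun setT g by apply: measurableT_comp => //; exact: measurable_cumulate.
have g0 M : 0 <= g M by exact: h0.
pose G (M : 'M[R]_(N + N, d)) := g (usubmx M) * g (dsubmx M).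
have mG : measurable_fun setT G.
  apply: measurable_funM; apply: measurableT_comp => //.
    exact: measurable_usubmx.
  exact: measurable_dsubmx.
have G0 M : 0 <= G M by rewrite mulr_ge0.
have E1 : (\int[BM]_w (h (increments s N (subn N) w) * h (increments s N (addn N) w))%:E =
    \int[law BM mreflect]_M (G M)%:E)%E.
  rewrite (ge0_integral_law BM mreflect mG G0); apply: eq_integral => w _.
  by rewrite backward_steps forward_steps.
have E2 : (\int[law BM mreflect]_M (G M)%:E = \int[mu \x mu]_p (g p.1 * g p.2)%:E)%E.
  transitivity (\int[pushforward (mu \x mu) glue_mx]_M (G M)%:E)%E.
    apply: eq_measure_integral => // ; first exact: measurable_glue_mx.
    by move=> mglue A mA _; exact: reflect_steps_law.
  rewrite ge0_integral_pushforward//.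
  - by apply: eq_integral => p _; rewrite /= /G /glue_mx col_mxKu col_mxKd.
  - exact: measurable_glue_mx.
  - exact/measurable_EFinP.
  - by move=> M _; rewrite lee_fin.
rewrite [LHS]/Rintegral E1 E2 integral_prod_mul// -EFin_Rintegral_bounded//.
  rewrite -EFinM/= expr2.
  suff -> : \int[mu]_M g M = \int[BM]_w h (increments s N id w) by [].
  rewrite /Rintegral (ge0_integral_law BM (measurable_steps (n := N)) mg g0); congr fine.
  by apply: eq_integral => w _; rewrite walk_steps.
exact: (bounded_fun_comp cumulate bh).
Qed.

End brownian_increments.

(** * Convergence in probability *)

Section convergence_in_probability.
Context {R : realType} {disp : measure_display} {Omega : measurableType disp}.
Variable Pr : probability Omega R.

(** Markov's inequality. *)
Lemma cvg_in_probability_L1 (Y : nat -> Omega -> R) (l : R) :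
  (forall n, measurable_fun setT (Y n)) -> (forall n, bounded_fun (Y n)) ->
  \int[Pr]_omega `|Y n omega - l| @[n --> \oo] --> (0 : R) ->
  cvg_in_probability Pr Y l.
Proof.
move=> mY bY Yl e e0; pose A n := [set omega | e <= `|Y n omega - l|].
have mYl n : measurable_fun setT (fun omega => `|Y n omega - l|).
  by apply: measurableT_comp => //; exact: measurable_funB.
have bYl n : bounded_fun (fun omega => `|Y n omega - l|).
  have [M YM] := (bounded_fun_leP (Y n)).1 (bY n); apply/bounded_fun_leP; exists (M + `|l|) => x.
  by rewrite normr_id (le_trans (ler_normB _ _))// lerD2r.
have mA n : measurable (A n).
  rewrite -[X in measurable X]setTI; apply: measurable_fun_le => //.
have PrA n : (Pr (A n) <= (e^-1 * \int[Pr]_omega `|Y n omega - l|)%:E)%E.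
  rewrite EFinM EFin_Rintegral_bounded// -ge0_integralZl_EFin//; last 2 first.
  - exact/measurable_EFinP.
  - by rewrite invr_ge0 ltW.
  rewrite -[X in Pr X]setIT -integral_indic//.
  apply: ge0_le_integral => //.
  - exact/measurable_EFinP/measurable_indic.
  - by apply: measurable_funeM; exact/measurable_EFinP.
  - move=> x _; rewrite -EFinM lee_fin indicE; case: (boolP (x \in A n)) => [/set_mem Ax|_].
      by rewrite mulrC ler_pdivlMr// mul1r.
    by rewrite mulr_ge0// invr_ge0 ltW.
have cvg0 : (e^-1 * \int[Pr]_omega `|Y n omega - l|)%:E @[n --> \oo] --> 0%E.
  by apply: cvg_EFin; [exact: nearW|rewrite -[X in _ --> X](mulr0 e^-1); exact: cvgMr].
apply: (@squeeze_cvge _ _ _ _ (cst 0%E) _ _ _ _ _ cvg0); last exact: cvg_cst.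
by apply: nearW => n /=; rewrite measure_ge0 PrA.
Qed.

End convergence_in_probability.

Section sampled_functional.
Context {R : realType} {d : nat}.
Variable (T : {posnum R}).

Lemma continuous_increments (S s : R) N tau (w : skorokhod d S) : continuous w ->
  (forall k, (k <= N)%N -> 0 <= (tau k)%:R * s <= S) ->
  increments s N tau v @[v --> w] --> increments s N tau w.
Proof.
move=> cw tauS.
pose u k j (v : skorokhod d S) : R := v ((tau k)%:R * s) 0 j.
have cvg_coord k j : (k <= N)%N -> u k j v @[v --> w] --> u k j w.
  move=> kN; apply: (@cvg_comp _ _ _ (fun v : skorokhod d S => v ((tau k)%:R * s))
    (fun x : 'rV[R]_d => x 0 j) (nbhs w) (nbhs (w ((tau k)%:R * s)))).
    by apply: continuous_eval_sk => //; exact: tauS.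
  exact: coord_continuous.
apply: (@cvg_mx _ _ _ _ (nbhs w) _ (fun v : skorokhod d S => increments s N tau v)).
move=> i j; rewrite mxE.
rewrite (_ : (fun v : skorokhod d S => _) = (u i.+1 j \- u 0%N j)); last first.
  by apply/funext => v; rewrite mxE.
by apply: (@cvgB _ _ _ (nbhs w) _ (u i.+1 j) (u 0%N j)); exact: cvg_coord.
Qed.

Lemma measurable_increments_sk (S s : R) N tau :
  measurable_fun setT (fun v : skorokhod d S => increments s N tau v).
Proof.
apply: measurable_fun_mx => k j; under eq_fun do rewrite mxE.
by apply: measurable_funB; apply: (measurableT_comp (f := fun v : 'rV[R]_d => v 0 j));
  do ?[exact: measurable_coord_mx|exact: measurable_eval_sk].
Qed.

Lemma increments_restr (S s : R) N tau (w : cadlag_path R d) :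
  (forall k, (k <= N)%N -> 0 <= (tau k)%:R * s <= S) ->
  increments s N tau (path_restr S w) = increments s N tau w.
Proof. by move=> tauS; apply/matrixP => i j; rewrite !mxE/= !clamp_id// tauS. Qed.

Variable F : skorokhod d T%:num -> R.
Hypotheses (cF : continuous F) (bF : bounded_fun F).

(** The functional F of the step path with prescribed displacements on the
    grid; the value at time 0 is 0, where the processes start. *)
Definition sampled N (M : 'M[R]_(N, d)) : R :=
  F (matrix_path T (col_mx (0 : 'rV[R]_d) M : 'M[R]_(N.+1, d))).

Lemma continuous_sampled N : continuous (@sampled N).
Proof.
move=> M; apply: (@cvg_comp _ _ _ (fun M : 'M[R]_(N, d) =>
  matrix_path T (col_mx (0 : 'rV[R]_d) M : 'M[R]_(N.+1, d)))
   F (nbhs M) (nbhs (matrix_path T (col_mx (0 : 'rV[R]_d) M : 'M[R]_(N.+1, d))))); last exact: cF.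
apply: (@cvg_comp _ _ _ (fun M : 'M[R]_(N, d) => col_mx (0 : 'rV[R]_d) M : 'M[R]_(N.+1, d))
   (matrix_path T (N := N)) (nbhs M) (nbhs (col_mx (0 : 'rV[R]_d) M : 'M[R]_(N.+1, d))));
     last exact: continuous_matrix_path.
apply: (@cvg_mx _ _ _ _ (nbhs M)) => i j; rewrite -[i]/(i : 'I_(1 + N)) -[i](@splitK 1 N).
case: (@fintype.split 1 N i) => k /=.
  rewrite [X in _ --> X]col_mxEu.
  have E (u : 'M[R]_(N, d)) : (col_mx (0 : 'rV[R]_d) u) (lshift N k) j = 0.
    by rewrite col_mxEu mxE.
  by rewrite [X in fmap X](funext E) mxE; exact: cvg_cst.
rewrite [X in _ --> X]col_mxEd.
have E (u : 'M[R]_(N, d)) : (col_mx (0 : 'rV[R]_d) u) (rshift 1 k) j = u k j.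
  by rewrite col_mxEd.
by rewrite [X in fmap X](funext E); exact: coord_continuous.
Qed.

Lemma sampled_discretize N (w : skorokhod d T%:num) : w 0 = 0 ->
  sampled (increments (T%:num / N%:R) N id w) = F (discretize T N w).
Proof.
move=> w0; rewrite /sampled /discretize /matrix_path; congr F.
apply: eq_step_path => -[|k] kN; apply/rowP => j; rewrite mxE.
  rewrite (_ : (inord 0 : 'I_N.+1) = lshift N (ord0 : 'I_1)); last by apply/val_inj;
    rewrite /= inordK.
  by rewrite [LHS](@col_mxEu _ 1 N) mxE /grid mul0r w0 mxE.
rewrite (_ : (inord k.+1 : 'I_N.+1) = rshift 1 (Ordinal kN)); last by apply/val_inj;
  rewrite /= inordK.
by rewrite [LHS](@col_mxEd _ 1 N) !mxE/= mul0r w0 mxE subr0.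
Qed.

End sampled_functional.

Section weak_convergence_in_measure.
Context {R : realType} {d : nat} {disp : measure_display}
  {Omega : measurableType disp}.
Variables (Pr : probability Omega R) (T : {posnum R})
  (BM : probability (cadlag_path R d) R) (delta : nat -> R) (c : nat -> {posnum R})
  (P : nat -> 'rV[R]_d -> Omega -> probability (cadlag_path R d) R).
Hypotheses (BM_std : standard_brownian BM) (delta_gt0 : forall n, 0 < delta n).
Hypothesis P_measurable : forall n x (A : set (cadlag_path R d)),
  lattice (delta n) x -> measurable A ->
  measurable_fun [set: Omega] (fun omega => P n x omega A).
Hypothesis P_markov : forall n omega,
  markov_process (lattice (delta n)) (fun x => P n x omega).
Hypothesis P_sym : forall n omega t, 0 <= t ->
  self_adjoint_L2 (lattice_measure (c n) (delta n))
    (semigroup (lattice (delta n)) (fun x => P n x omega) t).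
Hypothesis P_stationary : forall n x, lattice (delta n) x ->
  exists2 Tx : Omega -> Omega, measure_preserving Pr Tx &
  forall (S : R) (F : skorokhod d S -> R),
    0 < S -> measurable_fun setT F -> bounded_fun F ->
    (forall omega, path_expectation (P n x omega) F =
       path_expectation (P n 0 (Tx omega)) (fun w => F (sk_shift x w))) /\
    \int[Pr]_omega path_expectation (P n 0 (Tx omega)) F =
    \int[Pr]_omega path_expectation (P n 0 omega) F.
Hypothesis annealed_cvg : forall (S : R) (F : skorokhod d S -> R),
  0 < S -> continuous F -> bounded_fun F ->
  \int[Pr]_omega path_expectation (P n 0 omega) F @[n --> \oo] -->
  path_expectation BM F.

Let mP0 n A : measurable A -> measurable_fun setT (fun omega => P n 0 omega A).
Proof. by apply: P_measurable; exists 0 => //; exact: site0. Qed.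

Let mapping (S : {posnum R}) (H : skorokhod d S%:num -> R) :
  measurable_fun setT H -> bounded_fun H ->
  (forall w : skorokhod d S%:num, continuous w -> H v @[v --> w] --> H w) ->
  \int[Pr]_omega path_expectation (P n 0 omega) H @[n --> \oo] -->
  path_expectation BM H.
Proof.
apply: cvg_annealed_mapping; first exact: mP0.
  exact: brownian_continuous BM_std.
by move=> F; exact: annealed_cvg.
Qed.

Section fixed_grid.
Variable N : nat.
Hypothesis N_gt0 : (0 < N)%N.
Local Notation s := (T%:num / N%:R).
Local Notation walk := (increments (d := d) s N id).
Local Notation forward := (increments (d := d) s N (addn N)).
Local Notation backward := (increments (d := d) s N (subn N)).
Variable h : 'M[R]_(N, d) -> R.
Hypotheses (ch : continuous h) (bh : bounded_fun h) (h_ge0 : forall M, 0 <= h M).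

Let s_gt0 : 0 < s. Proof. by rewrite divr_gt0// ltr0n. Qed.

Let NsT : N%:R * s = T%:num. Proof. exact: grid_last. Qed.

Let mh : measurable_fun setT h. Proof. exact: continuous_measurable_mx. Qed.

Let walk_times k : (k <= N)%N -> 0 <= (id k)%:R * s <= T%:num.
Proof. by move=> kN; rewrite mulr_ge0 ?(ltW s_gt0)//= -[leRHS]NsT ler_wpM2r ?(ltW s_gt0)//
  ler_nat. Qed.

Let two_sided_times k : (k <= N + N)%N -> 0 <= k%:R * s <= T%:num + T%:num.
Proof.
move=> kN; rewrite mulr_ge0 ?(ltW s_gt0)//=.
have -> : T%:num + T%:num = (N + N)%:R * s by rewrite natrD mulrDl NsT.
by rewrite ler_wpM2r ?(ltW s_gt0)// ler_nat.
Qed.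

Let forward_times k : (k <= N)%N -> 0 <= (N + k)%:R * s <= T%:num + T%:num.
Proof. by move=> kN; apply: two_sided_times; rewrite leq_add2l. Qed.

Let backward_times k : (k <= N)%N -> 0 <= (N - k)%:R * s <= T%:num + T%:num.
Proof. by move=> kN; apply: two_sided_times; rewrite (leq_trans (leq_subr _ _))// leq_addr. Qed.

Lemma cvg_continuous_increments (S : R) tau (w : skorokhod d S) : continuous w ->
  (forall k, (k <= N)%N -> 0 <= (tau k)%:R * s <= S) ->
  h (increments s N tau (v : skorokhod d S)) @[v --> w] --> h (increments s N tau w).
Proof.
move=> cw tauS; apply: (@cvg_comp _ _ _ (fun v : skorokhod d S => increments s N tau v) h
  (nbhs w) (nbhs (increments s N tau w))); last exact: ch.
exact: continuous_increments.
Qed.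

Lemma cvg_annealed_walk :
  \int[Pr]_omega (\int[P n 0 omega]_w h (walk w)) @[n --> \oo] -->
  \int[BM]_w h (walk w).
Proof.
have E (mu : probability (cadlag_path R d) R) :
    path_expectation mu (fun v : skorokhod d T%:num => h (walk v)) = \int[mu]_w h (walk w).
  by apply: eq_Rintegral => w _; rewrite increments_restr//; exact: walk_times.
rewrite -E; under eq_fun do under eq_Rintegral do rewrite -E.
apply: mapping.
- by apply: measurableT_comp => //; exact: measurable_increments_sk.
- exact: (bounded_fun_comp (fun v : skorokhod d T%:num => walk v) bh).
- by move=> w cw; apply: cvg_continuous_increments => //; exact: walk_times.
Qed.

Lemma cvg_annealed_two_sided :
  \int[Pr]_omega (\int[P n 0 omega]_w (h (backward w) * h (forward w))) @[n --> \oo] -->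
  \int[BM]_w (h (backward w) * h (forward w)).
Proof.
have E (mu : probability (cadlag_path R d) R) :
    path_expectation mu (fun v : skorokhod d (T%:num + T%:num) =>
      h (backward v) * h (forward v)) =
    \int[mu]_w (h (backward w) * h (forward w)).
  apply: eq_Rintegral => w _; rewrite !increments_restr//.
rewrite -E; under eq_fun do under eq_Rintegral do rewrite -E.
apply: (@mapping (T%:num + T%:num)%:pos (fun v => h (backward v) * h (forward v))).
- by apply: measurable_funM; apply: measurableT_comp => //; exact: measurable_increments_sk.
- have [M hM] := (bounded_fun_leP h).1 bh.
  by apply/bounded_fun_leP; exists (M * M) => w; rewrite normrM ler_pM.
- move=> w cw; apply: (@cvgM _ _ (nbhs w) _ (fun v => h (backward v)) (fun v => h (forward v))).
    by apply: cvg_continuous_increments => //; exact: backward_times.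
  by apply: cvg_continuous_increments => //; exact: forward_times.
Qed.

Lemma bounded_walk (mu : Omega -> probability (cadlag_path R d) R) :
  bounded_fun (fun omega => \int[mu omega]_w h (walk w)).
Proof.
apply: bounded_Rintegral_kernel;
  last exact: (bounded_fun_comp (fun w : cadlag_path R d => walk w) bh).
by apply: measurableT_comp => //; exact: measurable_increments.
Qed.

Lemma measurable_walk n :
  measurable_fun setT (fun omega => \int[P n 0 omega]_w h (walk w)).
Proof.
apply: measurable_Rintegral_kernel; first exact: mP0.
  by apply: measurableT_comp => //; exact: measurable_increments.
exact: (bounded_fun_comp (fun w : cadlag_path R d => walk w) bh).
Qed.

(** Expand the square: both moments are annealed quantities, by
    [annealed_square], and the limits cancel by [brownian_square]. *)
Lemma cvg_variance_walk :
  \int[Pr]_omega ((\int[P n 0 omega]_w h (walk w) - \int[BM]_w h (walk w)) ^+ 2)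
    @[n --> \oo] --> (0 : R).
Proof.
set l := \int[BM]_w h (walk w).
have sq n : \int[Pr]_omega ((\int[P n 0 omega]_w h (walk w) - l) ^+ 2) =
    \int[Pr]_omega (\int[P n 0 omega]_w (h (backward w) * h (forward w)))
    - (l *+ 2) * (\int[Pr]_omega (\int[P n 0 omega]_w h (walk w))) + l ^+ 2.
  have mE := measurable_walk n; have bE := bounded_walk (P n 0).
  have [M EM] := (bounded_fun_leP _).1 bE.
  rewrite -(annealed_square (delta_gt0 n) s_gt0 N_gt0 (@P_measurable n) (P_markov n)
    (fun omega => @P_sym n omega s (ltW s_gt0)) (@P_stationary n) mh bh h_ge0).
  set E := (fun omega => \int[P n 0 omega]_w h (walk w)) in mE bE EM *.
  have iE : Pr.-integrable setT (EFin \o E) by exact: integrable_bounded.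
  have iE2 : Pr.-integrable setT (EFin \o (fun omega => E omega ^+ 2)).
    apply: integrable_bounded; first exact: measurable_funX.
    by apply/bounded_fun_leP; exists (M * M) => omega; rewrite normrX expr2;
      apply: ler_pM => //; exact: EM.
  have ilE : Pr.-integrable setT (EFin \o (fun omega => (l *+ 2) * E omega)).
    apply: integrable_bounded; first exact: measurable_funM.
    by apply/bounded_fun_leP; exists (`|l *+ 2| * M) => omega; rewrite normrM ler_wpM2l//;
      exact: EM.
  transitivity (\int[Pr]_omega (E omega ^+ 2 - (l *+ 2) * E omega + l ^+ 2)).
    by apply: eq_Rintegral => omega _; rewrite sqrrB mulrnAl [l * _]mulrC.
  have il : Pr.-integrable setT (EFin \o cst (l ^+ 2) : Omega -> \bar R).
    exact: finite_measure_integrable_cst.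
  rewrite RintegralD//; last exact: (integrableB measurableT iE2 ilE).
  by rewrite RintegralB// RintegralZl// Rintegral_cstT.
under eq_fun do rewrite sq.
have -> : (0 : R) = l ^+ 2 - (l *+ 2) * l + l ^+ 2 by rewrite expr2; ring.
apply: cvgD; last exact: cvg_cst.
apply: cvgB; last by apply: cvgMr; exact: cvg_annealed_walk.
by rewrite -(brownian_square BM_std s_gt0 mh bh h_ge0); exact: cvg_annealed_two_sided.
Qed.

End fixed_grid.

(** Adding a constant makes g nonnegative, as sums over trajectories
    require, and leaves the difference unchanged. *)
Lemma cvg_variance_walk_bounded N (g : 'M[R]_(N, d) -> R) : (0 < N)%N ->
  continuous g -> bounded_fun g ->
  \int[Pr]_omega ((\int[P n 0 omega]_w g (increments (T%:num / N%:R) N id w) -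
    \int[BM]_w g (increments (T%:num / N%:R) N id w)) ^+ 2) @[n --> \oo] --> (0 : R).
Proof.
move=> N0 cg /[dup] bg /bounded_fun_leP[M gM].
pose h A := g A + M.
have ch : continuous h by move=> A; apply: (@cvgD _ _ _ (nbhs A) _ g (cst M));
  [exact: cg|exact: cvg_cst].
have bh : bounded_fun h.
  apply/bounded_fun_leP; exists (M + `|M|) => A.
  by rewrite (le_trans (ler_normD _ _))// lerD2r.
have h0 A : 0 <= h A by have := gM A; rewrite ler_norml -lerBlDr sub0r => /andP[].
have E (mu : probability (cadlag_path R d) R) :
    \int[mu]_w h (increments (T%:num / N%:R) N id w) =
    \int[mu]_w g (increments (T%:num / N%:R) N id w) + M.
  rewrite RintegralD//; first by rewrite Rintegral_cstT.
    apply: integrable_bounded.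
      apply: measurableT_comp; first exact: continuous_measurable_mx.
      exact: measurable_increments.
    exact: (bounded_fun_comp (fun w : cadlag_path R d => increments (T%:num / N%:R) N id w) bg).
  exact: finite_measure_integrable_cst.
have := cvg_variance_walk N0 ch bh h0.
under eq_fun do under eq_Rintegral do rewrite !E opprD addrACA subrr addr0.
exact.
Qed.

Variable F : skorokhod d T%:num -> R.
Hypotheses (cF : continuous F) (bF : bounded_fun F).

Let mF : measurable_fun setT F. Proof. exact: measurable_continuous_sk. Qed.

Definition sampling_error N (v : skorokhod d T%:num) : R :=
  `|F v - sampled F (increments (T%:num / N%:R) N id v)|.

Let bsampled N : bounded_fun (sampled F (N := N)).
Proof. exact: (bounded_fun_comp (fun M =>
  matrix_path T (col_mx (0 : 'rV[R]_d) M : 'M[R]_(N.+1, d))) bF). Qed.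

Let msampled N : measurable_fun setT (sampled F (N := N)).
Proof. by apply: continuous_measurable_mx; exact: continuous_sampled. Qed.

Lemma measurable_sampling_error N : measurable_fun setT (sampling_error N).
Proof.
apply: measurableT_comp => //; apply: measurable_funB => //.
by apply: (measurableT_comp (f := @sampled _ _ T F N));
  [exact: msampled|exact: measurable_increments_sk].
Qed.

Let sampling_error_le : exists M, forall N v, `|sampling_error N v| <= M.
Proof.
have [M FM] := (bounded_fun_leP F).1 bF; exists (M + M) => N v.
by rewrite normr_id (le_trans (ler_normB _ _))// lerD// FM.
Qed.

Lemma bounded_sampling_error N : bounded_fun (sampling_error N).
Proof. by apply/bounded_fun_leP; have [M h] := sampling_error_le; exists M => v. Qed.

Let walk_times N k : (0 < N)%N -> (k <= N)%N -> 0 <= (id k)%:R * (T%:num / N%:R) <= T%:num.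
Proof.
move=> N0 kN; rewrite mulr_ge0//= -[leRHS](grid_last T N0).
by rewrite -/(grid T N k) ler_grid.
Qed.

(** Brownian paths start at 0, so the sampled functional is F at the
    discretization, which converges to the path. *)
Lemma cvg_sampling_error :
  path_expectation BM (sampling_error N) @[N --> \oo] --> (0 : R).
Proof.
have [M eM] := sampling_error_le.
rewrite -(Rintegral_cstT BM 0); apply: (@cvg_Rintegral_bounded _ _ _ _ _ _ M) => //.
- move=> N; apply: measurable_comp_restr; exact: measurable_sampling_error.
- have BM0 : {ae BM, forall w : cadlag_path R d, w 0 = 0}.
    apply: (@ae_full _ _ _ BM [set w : cadlag_path R d | w 0 = 0]).
      exact: measurable_eval_eq.
    exact: brownian_start BM_std.
  apply: filterS BM0 => w w0; apply/cvgrPdist_lt => e e0.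
  have r0 : path_restr T%:num w 0 = 0.
    rewrite /= clamp_id; first exact: w0.
    by rewrite lexx ltW.
  have /nbhs_ballP[/= r r0' rF] :
      nbhs (path_restr T%:num w) (F @^-1` ball (F (path_restr T%:num w)) e).
    by apply: cF; exact: nbhsx_ballx.
  apply: filterS (near_discretize (path_restr T%:num w) r0') => N wN.
  rewrite sub0r normrN normr_id sampled_discretize//.
  exact: rF.
Qed.

Lemma cvg_sampling_error_at N (w : skorokhod d T%:num) : (0 < N)%N ->
  continuous w -> sampling_error N v @[v --> w] --> sampling_error N w.
Proof.
move=> N0 cw; rewrite /sampling_error.
apply: (@cvg_norm _ _ _ (nbhs w)); apply: (@cvgB _ _ _ (nbhs w)); first exact: cF.
apply: (cvg_continuous_increments (continuous_sampled cF (N := N))) => // k.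
exact: walk_times.
Qed.

Lemma path_expectation_sampled (mu : probability (cadlag_path R d) R) N : (0 < N)%N ->
  `|path_expectation mu F - \int[mu]_w sampled F (increments (T%:num / N%:R) N id w)| <=
  path_expectation mu (sampling_error N).
Proof.
move=> N0.
have iF : mu.-integrable setT (EFin \o (fun w => F (path_restr T%:num w))).
  apply: integrable_bounded; first exact: measurable_comp_restr.
  exact: (bounded_fun_comp (path_restr T%:num) bF).
have iS : mu.-integrable setT
    (EFin \o (fun w : cadlag_path R d => sampled F (increments (T%:num / N%:R) N id w))).
  apply: integrable_bounded.
    by apply: (measurableT_comp (f := @sampled _ _ T F N));
      [exact: msampled|exact: measurable_increments].
  exact: (bounded_fun_comp (fun w : cadlag_path R d =>
    increments (T%:num / N%:R) N id w) (bsampled N)).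
rewrite -RintegralB//; apply: le_trans (le_normr_Rintegral _ _) _ => //.
  exact: (integrableB measurableT iF iS).
rewrite le_eqVlt; apply/orP; left; apply/eqP; apply: eq_Rintegral => w _.
rewrite /sampling_error increments_restr// => k; exact: walk_times.
Qed.

(** Three errors: F against its sampling under the process, the quenched
    against the Brownian expectation of the sampled functional, and the
    sampling error under Brownian motion.  The middle one is controlled by
    its variance. *)
Lemma quenched_cvg_in_probability :
  cvg_in_probability Pr (fun n omega => path_expectation (P n 0 omega) F)
    (path_expectation BM F).
Proof.
have mY n : measurable_fun setT (fun omega => path_expectation (P n 0 omega) F).
  exact: (measurable_path_expectation (Q := fun n omega => P n 0 omega) mP0).
have bY n : bounded_fun (fun omega => path_expectation (P n 0 omega) F).
  exact: (bounded_path_expectation (fun n omega => P n 0 omega)).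
apply: cvg_in_probability_L1 => //.
set l := path_expectation BM F.
apply/cvgrPdist_lt => e e0.
have th0 : 0 < e / 8 by rewrite divr_gt0.
have thi : 0 <= (e / 8)^-1 by rewrite invr_ge0 ltW.
have [N [N0 aN]] : exists N, (0 < N)%N /\ path_expectation BM (sampling_error N) < e / 8.
  have /cvgrPdist_lt/(_ _ th0) := cvg_sampling_error.
  move=> [N _ /(_ (maxn 1 N))]; rewrite /= leq_maxr => /(_ isT).
  rewrite sub0r normrN => h; exists (maxn 1 N); split; first by rewrite leq_max.
  exact: le_lt_trans (ler_norm _) h.
set a := path_expectation BM (sampling_error N) in aN.
have cA := mapping (measurable_sampling_error N) (bounded_sampling_error N)
  (fun w => cvg_sampling_error_at N0).
have cV := cvg_variance_walk_bounded N0 (continuous_sampled cF (N := N)) (bsampled N).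
set gam := \int[BM]_w sampled F (increments (T%:num / N%:R) N id w) in cV.
pose G n omega := \int[P n 0 omega]_w sampled F (increments (T%:num / N%:R) N id w).
pose A n omega := path_expectation (P n 0 omega) (sampling_error N).
have mA n : measurable_fun setT (A n).
  exact: (measurable_path_expectation (Q := fun n omega => P n 0 omega) mP0
    n (measurable_sampling_error N) (bounded_sampling_error N)).
have iA n : Pr.-integrable setT (EFin \o A n).
  apply: integrable_bounded => //.
  exact: (bounded_path_expectation (fun n omega => P n 0 omega) n
    (measurable_sampling_error N) (bounded_sampling_error N)).
have mG n : measurable_fun setT (G n).
  exact: (measurable_walk (continuous_sampled cF (N := N)) (bsampled N)).
have iG n : Pr.-integrable setT (EFin \o (fun omega => (e / 8)^-1 * (G n omega - gam) ^+ 2)).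
  have [M GM] := (bounded_fun_leP (G n)).1 (bounded_walk (continuous_sampled cF (N :=
    N)) (bsampled N) (P n 0)).
  apply: integrable_bounded.
    by apply: measurable_funM => //; apply: measurable_funX; exact: measurable_funB.
  apply/bounded_fun_leP; exists ((e / 8)^-1 * (M + `|gam|) ^+ 2) => omega.
  rewrite normrM (ger0_norm thi) ler_wpM2l// normrX.
  rewrite lerXn2r ?nnegrE// ?addr_ge0//; first exact: le_trans (GM omega).
  by rewrite (le_trans (ler_normB _ _))// lerD2r; exact: GM.
have ic r : Pr.-integrable setT (EFin \o (fun=> r) : Omega -> \bar R).
  exact: finite_measure_integrable_cst.
have iY n : Pr.-integrable setT
    (EFin \o (fun omega => `|path_expectation (P n 0 omega) F - l|)).
  have [M YM] := (bounded_fun_leP _).1 (bY n).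
  apply: integrable_bounded.
    by apply: measurableT_comp => //; exact: measurable_funB.
  apply/bounded_fun_leP; exists (M + `|l|) => omega.
  by rewrite normr_id (le_trans (ler_normB _ _))// lerD2r; exact: YM.
have YAG n omega : `|path_expectation (P n 0 omega) F - l| <=
    A n omega + (e / 8)^-1 * (G n omega - gam) ^+ 2 + (e / 8 + a).
  have h1 := path_expectation_sampled (P n 0 omega) N0.
  have h2 := path_expectation_sampled BM N0.
  (* Arithmetic-geometric mean inequality, with weight e / 8. *)
  have h3 : `|G n omega - gam| <= (e / 8)^-1 * (G n omega - gam) ^+ 2 + e / 8.
    rewrite -[(G n omega - gam) ^+ 2]real_normK ?num_real// -(ler_pM2l th0) mulrDr mulrA
      mulfV ?gt_eqF// mul1r.
    move: `|_| => z; rewrite -subr_ge0.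
    have -> : z ^+ 2 + e / 8 * (e / 8) - e / 8 * z = (z - e / 8 / 2) ^+ 2 + (e / 8) ^+ 2 * (3
      / 4).
      by field.
    by rewrite addr_ge0 ?sqr_ge0// mulr_ge0// sqr_ge0.
  have -> : path_expectation (P n 0 omega) F - l =
     (path_expectation (P n 0 omega) F - G n omega) + (G n omega - gam) + (gam - l).
    by rewrite !subrKA.
  apply: le_trans (ler_normD _ _) _.
  rewrite (addrA _ (e / 8)) lerD//; last by rewrite distrC.
  by apply: le_trans (ler_normD _ _) _; rewrite -addrA lerD.
have nA : \forall n \near \oo, `|a - \int[Pr]_omega A n omega| < e / 8.
  by move/cvgrPdist_lt : cA; apply.
have nV : \forall n \near \oo, `|0 - \int[Pr]_omega ((G n omega - gam) ^+ 2)| < e / 8 * (e / 8).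
  by move/cvgrPdist_lt : cV; apply; exact: mulr_gt0.
near=> n.
have hA : `|a - \int[Pr]_omega A n omega| < e / 8 by near: n.
have hV : `|0 - \int[Pr]_omega ((G n omega - gam) ^+ 2)| < e / 8 * (e / 8) by near: n.
have hY : \int[Pr]_omega `|path_expectation (P n 0 omega) F - l| <=
    \int[Pr]_omega A n omega + (e / 8)^-1 * \int[Pr]_omega ((G n omega - gam) ^+ 2) + (e / 8 + a).
  have iG2 : Pr.-integrable setT (EFin \o (fun omega => (G n omega - gam) ^+ 2)).
    have := integrableZl measurableT (e / 8) (iG n).
    apply: eq_integrable => // omega _.
    by rewrite /= -EFinM mulrA mulfV ?gt_eqF// mul1r.
  have iAG := integrableD measurableT (iA n) (iG n).
  rewrite -RintegralZl// -RintegralD// -[X in _ + X](Rintegral_cstT Pr) -RintegralD//.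
  apply: le_Rintegral => //; first exact: (integrableD measurableT iAG (ic _)).
rewrite sub0r normrN ger0_norm; last by apply: Rintegral_ge0.
apply: le_lt_trans hY _.
have V8 : (e / 8)^-1 * \int[Pr]_omega ((G n omega - gam) ^+ 2) < e / 8.
  rewrite mulrC ltr_pdivrMr// (le_lt_trans _ hV)// sub0r normrN; exact: ler_norm.
move: V8 hA; rewrite ltr_distl => V8 /andP[hA _]; move: V8 aN hA.
move: (_ * Rintegral _ _ _) => v; move: (Rintegral _ _ _) => u V8 aN hA; lra.
Unshelve. all: by end_near. Qed.

End weak_convergence_in_measure.

Theorem theorem2p13 (R : realType) (d : nat)
  (disp : measure_display) (Omega : measurableType disp)
  (Pr : probability Omega R)
  (T : R) (T_gt0 : 0 < T)
  (BM : probability (cadlag_path R d) R) (BM_std : standard_brownian BM)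
  (delta : nat -> R) (delta_gt0 : forall n, 0 < delta n)
  (delta_cvg : delta n @[n --> \oo] --> (0 : R))
  (c : nat -> {posnum R})
  (lambda_cvg : vague_cvg (fun n => lattice_measure (c n) (delta n))
     (@lebesgue_rV R d))
  (P : nat -> 'rV[R]_d -> Omega -> probability (cadlag_path R d) R)
  (P_measurable : forall n x (A : set (cadlag_path R d)),
     lattice (delta n) x -> measurable A ->
     measurable_fun [set: Omega] (fun omega => P n x omega A))
  (P_markov : forall n omega,
     markov_process (lattice (delta n)) (fun x => P n x omega))
  (assumption1 : forall n omega t, 0 <= t ->
     self_adjoint_L2 (lattice_measure (c n) (delta n))
       (semigroup (lattice (delta n)) (fun x => P n x omega) t))
  (assumption2 : forall n x, lattice (delta n) x ->
     exists2 Tx : Omega -> Omega, measure_preserving Pr Tx &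
     forall (S : R) (F : skorokhod d S -> R),
       0 < S -> measurable_fun setT F -> bounded_fun F ->
       (forall omega, path_expectation (P n x omega) F =
          path_expectation (P n 0 (Tx omega)) (fun w => F (sk_shift x w))) /\
       \int[Pr]_omega path_expectation (P n 0 (Tx omega)) F =
       \int[Pr]_omega path_expectation (P n 0 omega) F)
  (assumption3 : forall (S : R) (F : skorokhod d S -> R),
     0 < S -> continuous F -> bounded_fun F ->
     \int[Pr]_omega path_expectation (P n 0 omega) F @[n --> \oo] -->
     path_expectation BM F)
  (relcompact : {ae Pr, forall omega,
     relatively_compact_laws
       (range (fun n : nat => path_law T (P n 0 omega)))}) :
  forall F : skorokhod d T -> R, continuous F -> bounded_fun F ->
    cvg_in_probability Pr
      (fun n omega => path_expectation (P n 0 omega) F)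
      (path_expectation BM F).
Proof.
exact: (@quenched_cvg_in_probability R d disp Omega Pr (PosNum T_gt0) BM delta c P
  BM_std delta_gt0 P_measurable P_markov assumption1 assumption2 assumption3).
Qed.
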